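(* Let $A=\mathbb Z[x_s,x_t]$ and let $\Bbbk$ be an $A$-algebra which is a commutative domain and a Henselian local ring. Let $\widehat A$ be the completion of $\Bbbk[x_s,x_t]$ at the ideal $(x_s-[2]_s,\,x_t-[2]_t)$, where $[2]_s,[2]_t\in\Bbbk$ are the images of $x_s,x_t$, and let $Q$ be the fraction field of $\widehat A$. Let $n\ge0$ and suppose that the two-colored Jones-Wenzl projector $JW^{\Bbbk}_{n_s}$ exists over $\Bbbk$. Then it lifts to a Jones-Wenzl projector $JW^{\widehat A}_{n_s}$ over $\widehat A$ (i.e. $JW^{\widehat A}_{n_s}$ exists and its image under $(-)\otimes_{\widehat A}\Bbbk$ is $JW^{\Bbbk}_{n_s}$), and $JW^{\widehat A}_{n_s}$ specializes to the Jones-Wenzl projector $JW^{Q}_{n_s}$ over $Q$ under $(-)\otimes_{\widehat A}Q$.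
   Context: $\Bbbk[x_s,x_t]$ and $\widehat A\cong\Bbbk[[z_s,z_t]]$ ($z_u=x_u-[2]_u$) and $Q$ are $A$-algebras via $x_s\mapsto x_s$, $x_t\mapsto x_t$; the map $\widehat A\to\Bbbk$ sets $z_s=z_t=0$, so $x_u\mapsto[2]_u$. Two-colored Temperley-Lieb category $2\mathcal{TL}_{A'}$ over a commutative $A$-algebra $A'$: for $n\ge0$ and a color $u\in\{s,t\}$, the object $n_u$ is the alternating sequence of colors $s,t$ of length $n+1$ ending in $u$ ($n$ points on a line with the $n+1$ regions colored alternately, rightmost color $u$). $\mathrm{Hom}(n_u,k_u)$ (for $n\equiv k$ mod $2$) is the free $A'$-module on crossingless matchings with $n$ bottom and $k$ top points, regions colored alternately with rightmost color $u$; all other Homs are $0$. Composition is vertical stacking, a circle whose outside region has color $u$ being evaluated to $-x_u$. Base change along $A'\to A''$ gives functors $2\mathcal{TL}_{A'}\to2\mathcal{TL}_{A''}$. The Jones-Wenzl projector $JW^{A'}_{n_u}$, if it exists, is the unique element of $\mathrm{End}(n_u)$ whose coefficient of the identity matching is $1$ and which satisfies $JW_{n_u}\circ\mathrm{Hom}(k_u,n_u)=0$ for all $0\le k<n$ (equivalently, it is killed by all cups placed on the bottom; equivalently, by all caps placed on top). *)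

(* Defs.v *)
From HB Require Import structures.
From mathcomp Require Import all_boot all_order all_algebra.
From mathcomp Require Import fraction zify.
From mathcomp.multinomials Require Export mpoly.

Set Implicit Arguments.
Unset Strict Implicit.
Unset Printing Implicit Defensive.

Import Order.TTheory GRing.Theory Num.Theory.
Local Open Scope ring_scope.

(** * Colors and the base ring Z[x_s, x_t] *)

(* A color doubles as the index of the corresponding polynomial variable. *)
Definition color : Type := 'I_2.
Definition col_s : color := ord0.
Definition col_t : color := ord_max.
Definition other_color (u : color) : color := rev_ord u.

(* An A-algebra is a commutative ring R with a morphism {rmorphism A -> R}. *)
Notation A := {mpoly int[2]}.
Definition x_ (u : color) : A := 'X_u.

(** * Crossingless matchings *)

(* The pair (n, u) stands for the alternating color sequence n_u of length
   n + 1 ending in u: [region_color X i] is its i-th entry, i = 0, ..., n. *)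
Definition tl_obj : Type := (nat * color)%type.

Definition region_color (X : tl_obj) (i : nat) : color :=
  iter (X.1 - i) other_color X.2.

(* The boundary points of a diagram with bottom X and top Y: [inl i] is the
   i-th bottom point, [inr j] the j-th top point, counted from the left. *)
Notation tl_points X Y := ('I_(fst X) + 'I_(fst Y))%type.

(* Rank of a boundary point when going around the boundary of the strip
   counterclockwise: bottom from left to right, then top from right to left. *)
Definition boundary_rank (X Y : tl_obj) (p : tl_points X Y) : nat :=
  match p with
  | inl i => i
  | inr j => X.1 + (Y.1 - j.+1)
  end.

Definition perfect_matching (T : finType) (m : {ffun T -> T}) : bool :=
  [forall p, (m (m p) == p) && (m p != p)].

Definition noncrossing (X Y : tl_obj)
    (m : {ffun tl_points X Y -> tl_points X Y}) : bool :=
  let r := @boundary_rank X Y in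
  [forall p, forall q,
     ~~ [&& r p < r q, r q < r (m p) & r (m p) < r (m q)]%N].

(* The rightmost colors of X and Y must agree; the parity of the number of
   boundary points then makes the leftmost colors agree as well. *)
Record tl_diagram (X Y : tl_obj) := TLDiagram {
  tl_arc :> {ffun tl_points X Y -> tl_points X Y};
  tl_diagramP : [&& X.2 == Y.2, perfect_matching tl_arc & noncrossing tl_arc] }.

HB.instance Definition _ X Y := [isSub for @tl_arc X Y].
HB.instance Definition _ X Y := [Finite of tl_diagram X Y by <:].

Definition id_arc (X : tl_obj) : {ffun tl_points X X -> tl_points X X} :=
  [ffun p => match p with inl i => inr i | inr i => inl i end].

Lemma id_arcP (X : tl_obj) :
  [&& X.2 == X.2, perfect_matching (id_arc X) & noncrossing (id_arc X)].
Proof.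
apply/and3P; split=> //.
  by apply/forallP => -[i|i]; rewrite !ffunE eqxx.
apply/forallP => p; apply/forallP => q; rewrite !ffunE.
by case: p => i; case: q => j /=; have := ltn_ord i; have := ltn_ord j; lia.
Qed.

Definition id_diagram (X : tl_obj) : tl_diagram X X := TLDiagram (id_arcP X).

(** * Vertical stacking *)

Section Stacking.
Variables (X Y Z : tl_obj).

(* Points of the stack of a diagram E : X -> Y (below) and a diagram
   D : Y -> Z (above): bottom points, middle points, top points. *)
Definition stack_points : Type := ('I_(X.1) + 'I_(Y.1) + 'I_(Z.1))%type.
HB.instance Definition _ := Finite.on stack_points.

Definition lower_point (p : tl_points X Y) : stack_points := inl p.

Definition upper_point (p : tl_points Y Z) : stack_points :=
  match p with
  | inl y => inl (inr y)
  | inr z => inr z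
  end.

Definition outer_point (p : tl_points X Z) : stack_points :=
  match p with
  | inl x => inl (inl x)
  | inr z => inr z
  end.

Definition middle_point (y : 'I_(Y.1)) : stack_points := inl (inr y).

Definition stack_edge (D : tl_diagram Y Z) (E : tl_diagram X Y) :
    rel stack_points :=
  fun a b =>
    [exists p, (a == lower_point p) && (b == lower_point (E p))]
    || [exists p, (a == upper_point p) && (b == upper_point (D p))].

Definition stack_connect (D : tl_diagram Y Z) (E : tl_diagram X Y) :
    rel stack_points := connect (stack_edge D E).

(* F is the diagram left after deleting the circles from the stack.  A
   component of the stack that is not a circle is an arc with exactly two outer
   points, its ends, so there is exactly one such F. *)
Definition stacks_to (D : tl_diagram Y Z) (E : tl_diagram X Y)
    (F : tl_diagram X Z) : bool :=
  [forall p, stack_connect D E (outer_point p) (outer_point (F p))].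

(* A circle is a component without outer points; it is represented by the
   rightmost point where it meets the middle line. *)
Definition circle_right_end (D : tl_diagram Y Z) (E : tl_diagram X Y)
    (y : 'I_(Y.1)) : bool :=
  [forall p, ~~ stack_connect D E (middle_point y) (outer_point p)] &&
  [forall y' : 'I_(Y.1),
     stack_connect D E (middle_point y) (middle_point y') ==> (y' <= y)%N].

(* The middle line to the right of the rightmost point y of a circle does not
   meet the circle again, so the region following y is the one just outside. *)
Definition circles_value (R : comNzRingType) (phi : {rmorphism A -> R})
    (D : tl_diagram Y Z) (E : tl_diagram X Y) : R :=
  \prod_(y | circle_right_end D E y) - phi (x_ (region_color Y y.+1)).

End Stacking.

(** * The two-colored Temperley-Lieb category *)

(* The free R-module on the diagrams; zero if there are none. *)
Notation tl_hom R X Y := {ffun tl_diagram X Y -> R}.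

Definition tl_comp (R : comNzRingType) (phi : {rmorphism A -> R})
    (X Y Z : tl_obj) (g : tl_hom R Y Z) (f : tl_hom R X Y) : tl_hom R X Z :=
  [ffun F => \sum_(D : tl_diagram Y Z) \sum_(E : tl_diagram X Y | stacks_to D E F)
               circles_value phi D E * g D * f E].

Definition tl_base_change (R S : comNzRingType) (rho : {rmorphism R -> S})
    (X Y : tl_obj) (f : tl_hom R X Y) : tl_hom S X Y :=
  [ffun D => rho (f D)].

(* [f] is the Jones-Wenzl projector of n_u over the A-algebra (R, phi). *)
Definition is_JW (R : comNzRingType) (phi : {rmorphism A -> R})
    (n : nat) (u : color) (f : tl_hom R (n, u) (n, u)) : Prop :=
  f (id_diagram (n, u)) = 1 /\
  forall k : nat, (k < n)%N ->
    forall g : tl_hom R (k, u) (n, u), tl_comp phi f g = 0.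

(** * Ideals, Henselian local rings, adic completions *)

Definition is_ideal (R : comNzRingType) (I : R -> Prop) : Prop :=
  [/\ I 0, forall a b, I a -> I b -> I (a + b) & forall a b, I b -> I (a * b)].

Definition is_maximal_ideal (R : comNzRingType) (m : R -> Prop) : Prop :=
  [/\ is_ideal m, ~ m 1
    & forall J : R -> Prop, is_ideal J -> ~ J 1 ->
        (forall a, m a -> J a) -> forall a, J a -> m a].

Definition is_local_ring (R : comNzRingType) (m : R -> Prop) : Prop :=
  is_maximal_ideal m /\
  forall m' : R -> Prop, is_maximal_ideal m' -> forall a, m' a <-> m a.

(* Simple roots of monic polynomials over the residue field R/m lift to R;
   a root in R/m is given by a representative a0. *)
Definition is_henselian_local_ring (R : comNzRingType) : Prop :=
  exists m : R -> Prop, is_local_ring m /\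
  forall (f : {poly R}) (a0 : R), f \is monic ->
    m f.[a0] -> ~ m (f^`()).[a0] ->
    exists a : R, f.[a] = 0 /\ m (a - a0).

Definition ideal_gen (R : comNzRingType) (T : finType) (g : T -> R) : R -> Prop :=
  fun r => exists c : T -> R, r = \sum_i c i * g i.

Definition ideal_mul (R : comNzRingType) (I J : R -> Prop) : R -> Prop :=
  fun r => exists s : seq (R * R),
    (forall p, p \in s -> I p.1 /\ J p.2) /\ r = \sum_(p <- s) p.1 * p.2.

Fixpoint ideal_exp (R : comNzRingType) (I : R -> Prop) (n : nat) : R -> Prop :=
  if n is n'.+1 then ideal_mul I (ideal_exp I n') else fun=> True.

(* Rhat is the inverse limit of the rings R/I^n.  The projection of Rhat to
   R/I^n is recorded by its kernel [adic_ker n]: by [adic_ker_map] and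
   [adic_ker_surj] the map R -> Rhat identifies R/I^n with Rhat/adic_ker n. *)
Record adic_completion (R : comNzRingType) (I : R -> Prop)
    (Rhat : comNzRingType) := AdicCompletion {
  adic_map : {rmorphism R -> Rhat};
  adic_ker : nat -> Rhat -> Prop;
  adic_ker_ideal : forall n, is_ideal (adic_ker n);
  adic_ker_map : forall n r, adic_ker n (adic_map r) <-> ideal_exp I n r;
  adic_ker_surj : forall n b, exists r, adic_ker n (b - adic_map r);
  adic_ker_decr : forall n b, adic_ker n.+1 b -> adic_ker n b;
  adic_lim : forall r : nat -> R,
    (forall n, ideal_exp I n (r n.+1 - r n)) ->
    exists! b : Rhat, forall n, adic_ker n (b - adic_map (r n)) }.

(** * The rings k[x_s, x_t], its completion, and the structure maps *)

(* [2]_u *)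
Definition two_ (k : comNzRingType) (phi : {rmorphism A -> k}) (u : color) : k :=
  phi (x_ u).

(* The ideal generated by z_u = x_u - [2]_u, u = s, t. *)
Definition two_ideal (k : comNzRingType) (phi : {rmorphism A -> k}) :
    {mpoly k[2]} -> Prop :=
  ideal_gen (fun u : 'I_2 => 'X_u - (two_ phi u)%:MP).

Definition poly_str (k : comNzRingType) : {rmorphism A -> {mpoly k[2]}} :=
  map_mpoly (intr : int -> k).

Definition hat_str (k : comNzRingType) (phi : {rmorphism A -> k})
    (Ahat : comNzRingType) (C : adic_completion (two_ideal phi) Ahat) :
    {rmorphism A -> Ahat} :=
  adic_map C \o poly_str k.

Definition frac_map (R : idomainType) : {rmorphism R -> {fraction R}} :=
  @FracField.tofrac R.

Definition frac_str (R : idomainType) (psi : {rmorphism A -> R}) :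
    {rmorphism A -> {fraction R}} :=
  frac_map R \o psi.

(* [eps] is the map Ahat -> k with z_s = z_t = 0, i.e. the projection to
   k[x_s, x_t]/I followed by the evaluation x_u |-> [2]_u. *)
Definition is_special_fibre (k : comNzRingType) (phi : {rmorphism A -> k})
    (Ahat : comNzRingType) (C : adic_completion (two_ideal phi) Ahat)
    (eps : {rmorphism Ahat -> k}) : Prop :=
  forall (b : Ahat) (p : {mpoly k[2]}),
    adic_ker C 1 (b - adic_map C p) -> eps b = p.@[two_ phi].

(* Main.v *)
(* Let f be the projector over k and e = 1 - f.  Killing every Hom(m, n) with
   m < n means that e is a left identity of these modules and, since a
   non-identity diagram factors through fewer strands, of the ideal spanned by
   the non-identity endomorphism diagrams.  Lift e coefficientwise to e' over
   Ahat.  Elements of Ahat which specialize to 1 are units (geometric series),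
   so composition with e' is invertible on these modules.  Solve e' a = e'; then
   e' (a g) = e' g forces a g = g, and 1 - a is the lifted projector.

   This uses that stacking of diagrams is associative, including the colors of
   the circles.  Both this and planarity of a stack rest on a parity argument: if
   S is a union of components, the parity of the number of points of S to the
   right of a point outside S does not change when that point moves along its
   component. *)

Require Import Defs.
From HB Require Import structures.
From mathcomp Require Import all_boot all_order all_algebra.
From Stdlib Require Import IndefiniteDescription.
From mathcomp Require Import fraction zify ring.

Set Implicit Arguments.
Unset Strict Implicit.
Unset Printing Implicit Defensive.

Import GRing.Theory.
Local Open Scope ring_scope.

(** * Path components of two involutions *)

Section TwoInvolutions.
Local Open Scope nat_scope.
Variables (T : finType) (a b : T -> T).
Hypotheses (aK : involutive a) (bK : involutive b).

Definition involution_edge : rel T := fun x y => (y == a x) || (y == b x).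

Lemma involution_edge_sym : symmetric involution_edge.
Proof.
suff imp x y : involution_edge x y -> involution_edge y x.
  by move=> x y; apply/idP/idP; apply: imp.
by case/orP=> /eqP->; rewrite /involution_edge ?aK ?bK eqxx ?orbT.
Qed.

(* The component of a point p fixed by a is the cycle of p under the rotation
   x |-> a (b x), on which a and b act as reflections. *)
Lemma involution_component_ends p : a p = p -> b p != p ->
  exists q, [/\ q != p, connect involution_edge p q, (a q == q) || (b q == q)
    & forall r, connect involution_edge p r -> (a r == r) || (b r == r) ->
        r = p \/ r = q].
Proof.
pose g x := a (b x); move=> ap bp; pose N := order g p.
have g_inj : injective g by exact: inj_comp (inv_inj aK) (inv_inj bK).
have gN : iter N g p = p by exact: iter_order.
have iter_inj j : injective (iter j g) by elim: j => // j IH x y /g_inj /IH.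
have gag w : g (a (g w)) = a w by rewrite /g aK bK.
have gbg w : g (b (g w)) = b w by rewrite /g bK aK.
have iter_a j x : iter j g (a (iter j g x)) = a x.
  by elim: j => // j IH; rewrite iterSr iterS gag.
have iter_b j x : iter j g (b (iter j g x)) = b x.
  by elim: j => // j IH; rewrite iterSr iterS gbg.
(* Both involutions conjugate [g] to its inverse and [a] fixes [p], so they reverse the cycle: [a]
   sends index j to -j and [b] sends it to -j-1, modulo N. *)
have aE j : j <= N -> a (iter j g p) = iter (N - j) g p.
  move=> le_jN; apply: (iter_inj j).
  by rewrite iter_a ap -iterD subnKC // gN.
have bE j : j < N -> b (iter j g p) = iter (N - j.+1) g p.
  move=> lt_jN; apply: (iter_inj j.+1).
  by rewrite -iterD subnKC // gN iterS iter_b -[LHS]/(a (b (b p))) bK ap.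
have iterK i j : i < N -> j < N -> iter i g p = iter j g p -> i = j.
  by move=> lt_iN lt_jN eq_ij; rewrite -(findex_iter lt_iN) eq_ij findex_iter.
have N_gt1 : 1 < N.
  have N_gt0 : 0 < N by exact: order_gt0.
  rewrite ltn_neqAle N_gt0 andbT; apply: contraNneq bp => N1.
  by have := gN; rewrite -N1 /= => gp; rewrite -[b p]aK -/(g p) gp ap.
have connect_iter j : connect involution_edge p (iter j g p).
  elim: j => [|j IH]; first exact: connect0.
  apply: (connect_trans IH); apply: (@connect_trans _ _ (b (iter j g p))).
    by apply: connect1; rewrite /involution_edge eqxx orbT.
  by apply: connect1; rewrite /involution_edge iterS eqxx.
have iter_connect r : connect involution_edge p r ->
    exists2 j, j < N & r = iter j g p.
  move=> pr; suff gpr : fconnect g p r.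
    by exists (findex g p r); [exact: findex_max | rewrite iter_findex].
  case/connectP: pr => s; elim/last_ind: s r => [|s y IH] r.
    by move=> _ ->; exact: connect0.
  rewrite rcons_path last_rcons => /andP[ps sy] ->.
  have := IH _ ps erefl; set z := last p s in sy *.
  move=> pz; have lt_zN := findex_max pz; rewrite -(iter_findex pz) in sy.
  case/orP: sy => /eqP->; rewrite ?aE ?bE ?(ltnW lt_zN) //; exact: fconnect_iter.
(* Index 0 aside, a fixed index solves 2j = N for [a] or 2j + 1 = N for [b]; rounding N/2 down
   covers both parities. *)
exists (iter N./2 g p); split.
- apply/eqP => /(@iterK N./2 0) h; have := N_gt1; lia.
- exact: connect_iter.
- case: (boolP (odd N)) => oddN; apply/orP; [right | left]; apply/eqP.
    by rewrite bE; [congr (iter _ g p) | ]; lia.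
  by rewrite aE; [congr (iter _ g p) | ]; lia.
move=> r /iter_connect[j lt_jN ->].
(* Index 0 is [p] itself; there [aE] gives exponent N, outside the range of [iterK]. *)
rewrite aE ?(ltnW lt_jN) // bE //; case: j lt_jN => [|j] lt_jN; first by left.
case/orP=> /eqP/iterK eqj; right; congr (iter _ g p).
  by have := eqj ltac:(lia) ltac:(lia); lia.
by have := eqj ltac:(lia) ltac:(lia); lia.
Qed.
End TwoInvolutions.

(** * Parity for noncrossing matchings *)

Section InvolutionParity.
Local Open Scope nat_scope.

(** The orbits of [m] on [B] are pairs. The injective rank [r] selects the smaller point of each
    pair, and [m] exchanges the selected half with the other half. *)
Lemma card_involution_even (T : finType) (m : T -> T) (r : T -> nat)
    (B : pred T) :
    involutive m -> injective r -> (forall x, B (m x) = B x) ->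
    (forall x, B x -> m x != x) -> ~~ odd #|B|.
Proof.
move=> mK r_inj Bm mN; rewrite -sum1_card (bigID (fun x => r x < r (m x))) /=.
rewrite [X in _ + X](reindex_inj (inv_inj mK)) /=.
rewrite [X in _ + X](eq_bigl (fun x => (x \in B) && (r x < r (m x)))) ?addnn ?odd_double //.
move=> x; rewrite mK -!topredE /= Bm; case: (boolP (B x)) => //= /mN neq.
have : r x != r (m x) by rewrite eq_sym (inj_eq r_inj).
lia.
Qed.

Variables X Y : tl_obj.
Implicit Types (p q : tl_points X Y) (S : pred (tl_points X Y)).
Let r := @boundary_rank X Y.

Lemma boundary_rank_inj : injective (@boundary_rank X Y).
Proof.
move=> [i|i] [j|j] /=; have := ltn_ord i; have := ltn_ord j => ? ? eq_ij;
  by [lia | congr (_ _); apply: ord_inj; lia].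
Qed.

(** Its parity stands for the side of the curves in [S] on which [p] lies. *)
Definition right_count S p : nat :=
  match p with
  | inl i => #|[pred i' : 'I_(X.1) | S (inl i') && (i < i')]|
  | inr j => #|[pred j' : 'I_(Y.1) | S (inr j') && (j < j')]|
  end.

Definition below_count S p : nat := #|[pred q | S q && (r q < r p)]|.

(** On the bottom line, the points of [S] before and after [p] make up all bottom points of [S]. On
    the top line ranks decrease to the right, so the points of [S] preceding [p] are those to its
    right and all the bottom ones. The correction is the same for every [p]. *)
Lemma odd_right_count S p : ~~ S p ->
  odd (right_count S p) =
    odd (below_count S p) (+) odd #|[pred i : 'I_(X.1) | S (inl i)]|.
Proof.
rewrite /below_count -sum1_card big_sumType /= -oddD.
case: p => i Si; rewrite /right_count -!sum1_card.
  rewrite [X in odd (_ + X + _)]big1 => [|j /andP[_]]; last first.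
    rewrite /r /=; have := ltn_ord i; lia.
  rewrite [X in _ = odd (_ + X)](bigID (fun i' : 'I_(X.1) => i' < i)) /= addn0.
  rewrite addnA oddD [X in X (+) _](_ : _ = false) ?addFb; last first.
    apply/negbTE; rewrite [X in _ + X](_ : _ = \sum_(i' | S (inl i') && (i' < i)) 1).
      by rewrite addnn odd_double.
    exact: eq_bigl.
  congr odd; apply: eq_bigl => i' /=; rewrite !inE.
  case: (boolP (S _)) => //= Si'.
  have : i != i' by apply: contraNneq Si => ->.
  rewrite -val_eqE /=; lia.
rewrite [X in odd (X + _ + _)](_ : _ = \sum_(i' | S (inl i')) 1); last first.
  apply: eq_bigl => i'; rewrite inE /r /=; have := ltn_ord i'; lia.
rewrite [X in _ = odd (X + _)]addnC -addnA oddD addnn odd_double addbF.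
congr odd; apply: eq_bigl => j /=; rewrite !inE /r /=.
have := ltn_ord i; have := ltn_ord j; lia.
Qed.

Section Arc.
Variable m : {ffun tl_points X Y -> tl_points X Y}.
Hypotheses (m_perfect : perfect_matching m) (m_noncrossing : noncrossing m).

Lemma matchingK : involutive m.
Proof. by move=> p; move/forallP: m_perfect => /(_ p)/andP[/eqP]. Qed.

Lemma matching_neq p : m p != p.
Proof. by move/forallP: m_perfect => /(_ p)/andP[]. Qed.

Lemma matching_noncrossing p q :
  ~~ [&& r p < r q, r q < r (m p) & r (m p) < r (m q)].
Proof. by move/forallP: m_noncrossing => /(_ p)/forallP/(_ q). Qed.

(** No arc in [S] crosses the arc at [p], so the points of [S] strictly between its two ends are
    matched among themselves and their number is even. *)
Lemma below_count_arc S p : (forall q, S (m q) = S q) -> ~~ S p ->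
  odd (below_count S (m p)) = odd (below_count S p).
Proof.
move=> Sm; wlog lt_p : p / r p < r (m p) => [wlg|] Sp.
  have : r p != r (m p).
    by rewrite (inj_eq boundary_rank_inj) eq_sym matching_neq.
  rewrite neq_ltn => /orP[lt_p | lt_p]; first exact: wlg.
  by rewrite -[in RHS](matchingK p); apply/esym/wlg; rewrite ?matchingK ?Sm.
rewrite /below_count -!sum1_card (bigID (fun q => r q < r p)) /= oddD.
rewrite [X in _ (+) odd X](_ : _ = #|[pred q | S q && (r p < r q < r (m p))]|).
  rewrite [odd #|_|](negbTE (card_involution_even matchingK boundary_rank_inj _ _)).
  - rewrite addbF; congr odd; apply: eq_bigl => q; rewrite !inE /=; lia.
  - move=> q; rewrite /= Sm; case: (boolP (S q)) => //= Sq.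
    have neq_r q' : S q' -> r q' != r p /\ r q' != r (m p).
      move=> Sq'; rewrite !(inj_eq boundary_rank_inj); split.
        by apply: contraNneq Sp => <-.
      by apply: contraNneq Sp => Ep; rewrite -Sm -Ep.
    have [n1 n2] := neq_r _ Sq.
    have [n3 n4] := neq_r (m q) ltac:(by rewrite Sm).
    (* The six instances exclude every interleaving of the arc of [q] with the arc of [p]. *)
    have h1 := matching_noncrossing p q.
    have h2 := matching_noncrossing p (m q).
    have h3 := matching_noncrossing q p.
    have h4 := matching_noncrossing (m q) p.
    have h5 := matching_noncrossing (m q) (m p).
    have h6 := matching_noncrossing q (m p).
    rewrite ?matchingK in h1 h2 h3 h4 h5 h6; lia.
  - by move=> q _; exact: matching_neq.
rewrite -sum1_card; apply: eq_bigl => q; rewrite !inE.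
case: (boolP (S q)) => //= Sq.
have : r q != r p.
  by rewrite (inj_eq boundary_rank_inj); apply: contraNneq Sp => <-.
lia.
Qed.

Lemma right_count_arc S p : (forall q, S (m q) = S q) -> ~~ S p ->
  odd (right_count S (m p)) = odd (right_count S p).
Proof.
by move=> Sm Sp; rewrite !odd_right_count ?Sm // below_count_arc.
Qed.

End Arc.
End InvolutionParity.

(** * Stacking two diagrams *)

Lemma diagram_perfect X Y (D : tl_diagram X Y) : perfect_matching D.
Proof. by case/and3P: (tl_diagramP D). Qed.

Lemma diagram_noncrossing X Y (D : tl_diagram X Y) : noncrossing D.
Proof. by case/and3P: (tl_diagramP D). Qed.

Lemma diagram_color X Y (D : tl_diagram X Y) : X.2 = Y.2.
Proof. by case/and3P: (tl_diagramP D) => /eqP. Qed.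

Lemma diagramK X Y (D : tl_diagram X Y) : involutive D.
Proof. exact: matchingK (diagram_perfect D). Qed.

Lemma diagram_neq X Y (D : tl_diagram X Y) p : D p != p.
Proof. exact: matching_neq (diagram_perfect D) p. Qed.

Lemma diagram_eqP X Y (D D' : tl_diagram X Y) :
  (forall p, D p = D' p) -> D = D'.
Proof. by move=> eqD; apply/val_inj/ffunP. Qed.

Section Stack.
Variables (X Y Z : tl_obj) (D : tl_diagram Y Z) (E : tl_diagram X Y).
Local Open Scope nat_scope.
Implicit Types a b : stack_points X Y Z.
Notation conn := (stack_connect D E).

(** The arcs are encoded as two involutions of the whole stack, each fixing the points it does not
    reach. The outer points become the fixed points, and [involution_component_ends] applies. *)
Definition lower_move a : stack_points X Y Z :=
  match a with
  | inl p => lower_point Z (E p)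
  | inr z => inr z
  end.

Definition upper_move a : stack_points X Y Z :=
  match a with
  | inl (inl x) => inl (inl x)
  | inl (inr y) => upper_point X (D (inl y))
  | inr z => upper_point X (D (inr z))
  end.

Lemma upper_moveE p : upper_move (upper_point X p) = upper_point X (D p).
Proof. by case: p. Qed.

Lemma lower_moveK : involutive lower_move.
Proof. by case=> [p|z] //=; rewrite /lower_point /= diagramK. Qed.

Lemma upper_moveK : involutive upper_move.
Proof.
by case=> [[x|y]|z] //; rewrite [X in _ X]/= upper_moveE diagramK.
Qed.

(** The moves add only loops at fixed points to the stack edges. *)
Lemma stack_connectE : conn =2 connect (involution_edge lower_move upper_move).
Proof.
move=> a b; apply/idP/idP; apply: connect_sub a b => a b.
  case/orP=> /existsP[p /andP[/eqP-> /eqP->]]; apply: connect1.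
    by rewrite /involution_edge eqxx.
  by rewrite /involution_edge upper_moveE eqxx orbT.
case/orP=> /eqP->.
  case: a => [p|z] /=; last exact: connect0.
  by apply/connect1/orP; left; apply/existsP; exists p; rewrite !eqxx.
have up p : conn (upper_point X p) (upper_point X (D p)).
  by apply/connect1/orP; right; apply/existsP; exists p; rewrite !eqxx.
case: a => [[x|y]|z]; [exact: connect0 | exact: (up (inl y)) | exact: (up (inr z))].
Qed.

Lemma stack_connect_sym a b : conn a b = conn b a.
Proof.
rewrite !stack_connectE; apply/sym_connect_sym/involution_edge_sym.
  exact: lower_moveK.
exact: upper_moveK.
Qed.

Lemma stack_connect_lower p : conn (lower_point Z p) (lower_point Z (E p)).
Proof. by rewrite stack_connectE connect1 // /involution_edge eqxx. Qed.

Lemma stack_connect_upper p : conn (upper_point X p) (upper_point X (D p)).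
Proof.
by rewrite stack_connectE connect1 // /involution_edge upper_moveE eqxx orbT.
Qed.

Lemma outer_point_inj : injective (@outer_point X Y Z).
Proof. by case=> [x|z] [x'|z'] //= []->. Qed.

Lemma lower_move_fixed x : lower_move x = x -> exists z, x = inr z.
Proof.
case: x => [p|z] /= => [[Ep]|]; last by exists z.
by have := diagram_neq E p; rewrite Ep eqxx.
Qed.

Lemma upper_move_fixed y : upper_move y = y -> exists x, y = inl (inl x).
Proof.
case: y => [[x|y]|z] /= => [_|Dy|Dz]; first by exists x.
- have := diagram_neq D (inl y); case: (D _) Dy => //= y' [->].
  by rewrite eqxx.
- have := diagram_neq D (inr z); case: (D _) Dz => //= z' [->].
  by rewrite eqxx.
Qed.

(** An outer point is fixed by exactly one of the two moves, so its component has a single other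
    end, which is again fixed by a move and therefore outer. *)
Lemma stack_path_ends p : exists q,
  [/\ q != p, conn (outer_point Y p) (outer_point Y q)
    & forall r, conn (outer_point Y p) (outer_point Y r) -> r = p \/ r = q].
Proof.
have outer_fixed r : (lower_move (outer_point Y r) == outer_point Y r) ||
    (upper_move (outer_point Y r) == outer_point Y r).
  by case: r => r /=; rewrite ?eqxx ?orbT.
have fixed_outer a : (lower_move a == a) || (upper_move a == a) ->
    exists q, a = outer_point Y q.
  case/orP=> /eqP; first by case/lower_move_fixed=> z ->; exists (inr z).
  by case/upper_move_fixed=> x ->; exists (inl x).
have [b [neq_b pb fix_b b_ends]] : exists b,
  [/\ b != outer_point Y p, conn (outer_point Y p) b,
      (lower_move b == b) || (upper_move b == b)
    & forall r, conn (outer_point Y p) r ->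
        (lower_move r == r) || (upper_move r == r) ->
        r = outer_point Y p \/ r = b].
  case: p => [x|z] /=.
    (* A bottom point is fixed by [upper_move], so the two moves exchange roles here. *)
    have [] := @involution_component_ends _ _ _ upper_moveK lower_moveK
      (inl (inl x)) erefl.
      by apply/eqP=> /lower_move_fixed[].
    have edgeC : involution_edge upper_move lower_move =2
      involution_edge lower_move upper_move by move=> a b; rewrite /involution_edge orbC.
    move=> b [? cb fb rb]; exists b; split=> //; last 1 first.
    - move=> r; rewrite stack_connectE -(eq_connect edgeC) orbC; exact: rb.
    - by rewrite stack_connectE -(eq_connect edgeC).
    - by rewrite orbC.
  have [] := @involution_component_ends _ _ _ lower_moveK upper_moveK
    (inr z) erefl.
    by apply/eqP=> /upper_move_fixed[].
  move=> b [? cb fb rb]; exists b; split=> //; first by rewrite stack_connectE.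
  by move=> r; rewrite stack_connectE; exact: rb.
have [q def_b] := fixed_outer _ fix_b.
move: neq_b pb b_ends; rewrite {b fix_b}def_b (inj_eq outer_point_inj).
move=> neq_b pb b_ends.
exists q; split=> // r /b_ends/(_ (outer_fixed r)).
by case=> /outer_point_inj; [left | right].
Qed.

(** The other end of the component of [p]; by [stack_arcP] the default [p] is never taken. *)
Definition stack_arc : {ffun tl_points X Z -> tl_points X Z} :=
  [ffun p => odflt p
     [pick q | (q != p) && conn (outer_point Y p) (outer_point Y q)]].

Lemma stack_arcP p : stack_arc p != p /\
  conn (outer_point Y p) (outer_point Y (stack_arc p)).
Proof.
rewrite ffunE; case: pickP => [q /andP[]//|].
by have [q [neq pq _]] := stack_path_ends p; move/(_ q); rewrite neq pq.
Qed.

Lemma stack_arc_connect p q :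
  conn (outer_point Y p) (outer_point Y q) = (q == p) || (q == stack_arc p).
Proof.
have [neq pFp] := stack_arcP p.
apply/idP/orP => [|[]/eqP-> //]; last exact: connect0.
have [q' [_ _ ends]] := stack_path_ends p; move/ends.
case: (ends _ pFp) => [Fp | ->]; first by rewrite Fp eqxx in neq.
by case=> ->; [left | right].
Qed.

Lemma stack_arcK : involutive stack_arc.
Proof.
move=> p; have [neq pFp] := stack_arcP p.
rewrite stack_connect_sym stack_arc_connect eq_sym (negbTE neq) in pFp.
by rewrite -(eqP pFp).
Qed.

(** A middle point is a top point of [E] and a bottom point of [D]. Both readings give the same
    count, which lets the parity pass from one diagram to the other. *)
Definition stack_right_count (S : pred (stack_points X Y Z)) a : nat :=
  match a with
  | inl p => right_count (S \o lower_point Z) p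
  | inr z => right_count (S \o @upper_point X Y Z) (inr z)
  end.

Lemma stack_right_count_upper S p :
  stack_right_count S (upper_point X p) = right_count (S \o @upper_point X Y Z) p.
Proof. by case: p. Qed.

Lemma stack_right_count_outer S p :
  stack_right_count S (outer_point Y p) = right_count (S \o @outer_point X Y Z) p.
Proof. by case: p. Qed.

Lemma stack_right_count_connect S a b :
    (forall v, S (lower_move v) = S v) -> (forall v, S (upper_move v) = S v) ->
    ~~ S a -> conn a b ->
  odd (stack_right_count S b) = odd (stack_right_count S a).
Proof.
(* The induction along the path also needs that it never enters [S], as [right_count_arc] requires
   at each arc. *)
move=> Sl Su Sa ab; suff [] : ~~ S b /\
  odd (stack_right_count S b) = odd (stack_right_count S a) by [].
have SE p : S (lower_point Z (E p)) = S (lower_point Z p).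
  exact: (Sl (lower_point Z p)).
have SD p : S (upper_point X (D p)) = S (upper_point X p).
  by rewrite -upper_moveE Su.
case/connectP: ab => s; elim/last_ind: s b => [|s c IH] b; first by move=> _ ->.
rewrite rcons_path last_rcons => /andP[/IH/(_ erefl)]; move: (last a s) => d.
move=> [Sd <-] /orP[]/existsP[p /andP[/eqP def_d /eqP def_c]] ->.
  rewrite def_c SE -def_d Sd; split=> //.
  rewrite {}def_d in Sd *; apply: right_count_arc => //.
  - exact: diagram_perfect.
  - exact: diagram_noncrossing.
rewrite def_c SD -def_d Sd; split=> //.
rewrite {}def_d in Sd *; rewrite !stack_right_count_upper.
apply: right_count_arc => //.
- exact: diagram_perfect.
- exact: diagram_noncrossing.
Qed.

(* If p -- Fp crossed q -- Fq, the component of p would lie to the right of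
   exactly one of q and Fq an odd number of times. *)
Lemma stack_arcP_diagram :
  [&& X.2 == Z.2, perfect_matching stack_arc & noncrossing stack_arc].
Proof.
apply/and3P; split; first by rewrite (diagram_color E) (diagram_color D).
  by apply/forallP=> p; rewrite stack_arcK eqxx; case: (stack_arcP p).
apply/forallP=> p; apply/forallP=> q; apply/negP=> /and3P[pq qFp FpFq].
pose S := conn (outer_point Y p).
have S_outer r : S (outer_point Y r) = (r == p) || (r == stack_arc p).
  exact: stack_arc_connect.
have Sl v : S (lower_move v) = S v.
  rewrite /S ![conn (outer_point Y p) _]stack_connect_sym.
  apply/same_connect; first exact: stack_connect_sym.
  by rewrite -/conn stack_connect_sym stack_connectE connect1 // /involution_edge eqxx.
have Su v : S (upper_move v) = S v.
  rewrite /S ![conn (outer_point Y p) _]stack_connect_sym.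
  apply/same_connect; first exact: stack_connect_sym.
  by rewrite -/conn stack_connect_sym stack_connectE connect1 // /involution_edge eqxx orbT.
have neq_rank u v : boundary_rank u < boundary_rank v -> (u == v :> tl_points X Z) = false.
  by move=> lt_uv; apply: contraTF lt_uv => /eqP->; rewrite ltnn.
have Sq : ~~ S (outer_point Y q).
  by rewrite S_outer eq_sym !neq_rank.
have SFq : ~~ S (outer_point Y (stack_arc q)).
  rewrite S_outer (eq_sym _ p) (eq_sym _ (stack_arc p)) !neq_rank //.
  exact: ltn_trans pq (ltn_trans qFp FpFq).
have [_ qFq] := stack_arcP q.
have := stack_right_count_connect Sl Su Sq qFq.
rewrite !stack_right_count_outer !odd_right_count // => /addIb.
(* Of the two outer points of [S], only [p] precedes [q] while both precede [stack_arc q], so the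
   parities differ. *)
suff [-> ->] : below_count (S \o @outer_point X Y Z) (stack_arc q) = 2 /\
  below_count (S \o @outer_point X Y Z) q = 1 by [].
rewrite /below_count; split.
  rewrite (eq_card (B := pred2 p (stack_arc p))); last first.
    move=> r; rewrite !inE /= S_outer; case: eqP => [->|_] /=; first lia.
    case: eqP => [->|//]; lia.
  by rewrite card2 eq_sym; case: (stack_arcP p) => ->.
rewrite (eq_card (B := pred1 p)) ?card1 // => r; rewrite !inE /= S_outer.
case: eqP => [->|_] /=; first lia.
case: eqP => [->|//]; lia.
Qed.

Definition tl_stack : tl_diagram X Z := TLDiagram stack_arcP_diagram.

Lemma stack_connect_outer p q :
  conn (outer_point Y p) (outer_point Y q) = (q == p) || (q == tl_stack p).
Proof. exact: stack_arc_connect. Qed.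

Lemma stacks_toE F : stacks_to D E F = (F == tl_stack).
Proof.
apply/forallP/eqP => [toF|-> p]; last by rewrite stack_connect_outer eqxx orbT.
apply: diagram_eqP => p; apply/eqP; move: (toF p).
by rewrite stack_connect_outer (negbTE (diagram_neq F p)).
Qed.

End Stack.

(** * Associativity of stacking *)

Section Contraction.
Variables (U V T : finType) (k : U -> T) (j : V -> T).
Variables (eU : rel U) (eV : rel V) (e : rel T) (outer : pred V).
Hypotheses (k_inj : injective k) (j_inj : injective j).
Hypothesis eU_e : forall a b, eU a b -> connect e (k a) (k b).
Hypothesis eV_e : forall v w, eV v w -> e (j v) (j w).
Hypothesis e_split : forall s t, e s t ->
  (exists a b, [/\ s = k a, t = k b & eU a b]) \/
  (exists v w, [/\ s = j v, t = j w & eV v w]).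
Hypothesis overlap_outer : forall a v, k a = j v -> outer v.
Hypothesis overlap_connect : forall a b v w, k a = j v -> k b = j w ->
  connect eV v w -> connect eU a b.

Lemma connect_from (C : finType) (c : rel C) (P : C -> Prop) s :
  P s -> (forall t t', P t -> c t t' -> P t') -> forall t, connect c s t -> P t.
Proof.
move=> Ps Pstep t /connectP[p]; elim: p s Ps => [|t' p IH] s Ps /=.
  by move=> _ ->.
by case/andP=> st' /IH; apply; exact: Pstep Ps st'.
Qed.

Lemma connect_embed v w : connect eV v w -> connect e (j v) (j w).
Proof.
apply: (connect_from (P := fun t => connect e (j v) (j t))) => [|t t' vt tt'].
  exact: connect0.
exact: connect_trans vt (connect1 (eV_e tt')).
Qed.

(** A walk in [T] between points of [U] alternates between edges of [U] and excursions into [V]. A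
    completed excursion starts and ends in the overlap, where [overlap_connect] replaces it by a
    path in [U]. *)
Lemma connect_contract a b : connect eU a b = connect e (k a) (k b).
Proof.
apply/idP/idP.
  apply: (connect_from (P := fun t => connect e (k a) (k t))) => [|t t' at_ /eU_e tt'].
    exact: connect0.
  exact: connect_trans tt'.
(* Invariant of the walk: it is at the point [c] of [U], or on an excursion into [V] that left [U]
   at [c]. *)
pose P t := exists2 c, connect eU a c & t = k c \/
  exists v w, [/\ k c = j v, t = j w & connect eV v w].
move=> ab; have [] : P (k b).
  apply: (connect_from (P := P)) ab => [|t t' [c ac tc] /e_split tt'].
    by exists a; [exact: connect0 | left].
  case: tt' => [[a' [b' [ta' tb' ab']]]|[v' [w' [tv' tw' vw']]]].
    exists b'; last by left.
    apply: connect_trans (connect1 ab'); apply: (connect_trans ac).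
    case: tc => [tc|[v [w [cv tw vw]]]].
      by rewrite (k_inj (etrans (esym tc) ta')) connect0.
    by apply: (overlap_connect cv _ vw); rewrite -ta'.
  exists c => //; right; case: tc => [tc|[v [w [cv tw vw]]]].
    by exists v', w'; split; rewrite ?connect1 // -tc.
  exists v, w'; split=> //; apply: (connect_trans vw); apply: connect1.
  by rewrite (j_inj (etrans (esym tw) tv')).
move=> c ac [/k_inj -> //|[v [w [cv bw vw]]]].
exact: connect_trans ac (overlap_connect cv bw vw).
Qed.

(** A walk can leave the component only along an edge of [U], whose starting point would lie in the
    overlap and hence be outer. *)
Lemma connect_inner v t : (forall w, connect eV v w -> ~~ outer w) ->
  connect e (j v) t -> exists2 w, t = j w & connect eV v w.
Proof.
move=> v_in; move: t.
apply: (connect_from (P := fun t => exists2 w, t = j w & connect eV v w)) =>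
  [|t t' [w def_t vw] /e_split].
  by exists v; rewrite ?connect0.
case=> [[a [b [ta tb ab]]]|[v' [w' [tv' tw' vw']]]].
  by have := v_in _ vw; rewrite (@overlap_outer a) // -ta.
exists w' => //; apply: (connect_trans vw); apply: connect1.
by rewrite (j_inj (etrans (esym def_t) tv')).
Qed.

End Contraction.

(** * Stacks of three diagrams *)

Section TripleStack.
Local Open Scope nat_scope.
Variables (W X Y Z : tl_obj).
Variables (D : tl_diagram Y Z) (E : tl_diagram X Y) (G : tl_diagram W X).

Definition triple_points : Type :=
  ('I_(W.1) + 'I_(X.1) + 'I_(Y.1) + 'I_(Z.1))%type.
HB.instance Definition _ := Finite.on triple_points.

Definition bottom_level (p : tl_points W X) : triple_points := inl (inl p).
Definition middle_level (p : tl_points X Y) : triple_points :=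
  match p with inl x => inl (inl (inr x)) | inr y => inl (inr y) end.
Definition top_level (p : tl_points Y Z) : triple_points :=
  match p with inl y => inl (inr y) | inr z => inr z end.

Definition triple_edge : rel triple_points := fun s t =>
  [|| [exists p, (s == bottom_level p) && (t == bottom_level (G p))],
      [exists p, (s == middle_level p) && (t == middle_level (E p))]
    | [exists p, (s == top_level p) && (t == top_level (D p))]].

Notation conn := (connect triple_edge).

Lemma bottom_edge p : triple_edge (bottom_level p) (bottom_level (G p)).
Proof. by apply/or3P/Or31/existsP; exists p; rewrite !eqxx. Qed.
Lemma middle_edge p : triple_edge (middle_level p) (middle_level (E p)).
Proof. by apply/or3P/Or32/existsP; exists p; rewrite !eqxx. Qed.
Lemma top_edge p : triple_edge (top_level p) (top_level (D p)).
Proof. by apply/or3P/Or33/existsP; exists p; rewrite !eqxx. Qed.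

Lemma triple_edgeP s t : triple_edge s t ->
  [\/ exists2 p, s = bottom_level p & t = bottom_level (G p),
      exists2 p, s = middle_level p & t = middle_level (E p)
    | exists2 p, s = top_level p & t = top_level (D p)].
Proof.
by case/or3P=> /existsP[p /andP[/eqP-> /eqP->]];
   [apply: Or31 | apply: Or32 | apply: Or33]; exists p.
Qed.

Lemma triple_connect_sym : connect_sym triple_edge.
Proof.
apply: sym_connect_sym; suff imp s t : triple_edge s t -> triple_edge t s.
  by move=> s t; apply/idP/idP; apply: imp.
case/triple_edgeP=> -[p -> ->].
- by rewrite -{2}(diagramK G p); exact: bottom_edge.
- by rewrite -{2}(diagramK E p); exact: middle_edge.
- by rewrite -{2}(diagramK D p); exact: top_edge.
Qed.

Definition lower_pair (a : stack_points W X Y) : triple_points := inl a.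
Definition upper_pair (a : stack_points X Y Z) : triple_points :=
  match a with
  | inl (inl x) => inl (inl (inr x))
  | inl (inr y) => inl (inr y)
  | inr z => inr z
  end.
(** The line Y disappears when [D] and [E] are replaced by their composite; [skip_X] plays the same
    role for [E] and [G]. *)
Definition skip_Y (a : stack_points W X Z) : triple_points :=
  match a with inl p => inl (inl p) | inr z => inr z end.
Definition skip_X (a : stack_points W Y Z) : triple_points :=
  match a with
  | inl (inl w) => inl (inl (inl w))
  | inl (inr y) => inl (inr y)
  | inr z => inr z
  end.

Let lower_pair_inj : injective lower_pair.
Proof. by move=> a b []. Qed.
Let upper_pair_inj : injective upper_pair.
Proof. by move=> [[?|?]|?] [[?|?]|?] //= [->]. Qed.
Let skip_Y_inj : injective skip_Y.
Proof. by move=> [?|?] [?|?] //= [->]. Qed.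
Let skip_X_inj : injective skip_X.
Proof. by move=> [[?|?]|?] [[?|?]|?] //= [->]. Qed.

Lemma upper_pair_edge v w : stack_edge D E v w ->
  triple_edge (upper_pair v) (upper_pair w).
Proof.
case/orP=> /existsP[p /andP[/eqP-> /eqP->]].
  by have := middle_edge p; case: p (E p) => p [q|q].
by have := top_edge p; case: p (D p) => p [q|q].
Qed.

Lemma lower_pair_edge v w : stack_edge E G v w ->
  triple_edge (lower_pair v) (lower_pair w).
Proof.
case/orP=> /existsP[p /andP[/eqP-> /eqP->]]; first exact: bottom_edge.
by have := middle_edge p; case: p (E p) => p [q|q].
Qed.

Let is_outer {X' Y' Z' : tl_obj} (v : stack_points X' Y' Z') :=
  [exists p, v == outer_point Y' p].

Lemma skip_Y_overlap a v : skip_Y a = upper_pair v ->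
  exists2 p, a = upper_point W p & v = outer_point Y p.
Proof.
case: a v => [[w|x]|z] [[x'|y']|z'] //= [] ->.
  by exists (inl x').
by exists (inr z').
Qed.

Lemma skip_X_overlap a v : skip_X a = lower_pair v ->
  exists2 p, a = lower_point Z p & v = outer_point X p.
Proof.
case: a v => [[w|y]|z] [[w'|x']|y'] //= [] ->.
  by exists (inl w').
by exists (inr y').
Qed.

Let skip_Y_split s t : triple_edge s t ->
  (exists a b, [/\ s = skip_Y a, t = skip_Y b & stack_edge (tl_stack D E) G a b]) \/
  (exists v w, [/\ s = upper_pair v, t = upper_pair w & stack_edge D E v w]).
Proof.
case/triple_edgeP=> -[p -> ->]; [left | right | right].
- exists (lower_point Z p), (lower_point Z (G p)); split=> //.
  by apply/orP; left; apply/existsP; exists p; rewrite !eqxx.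
- exists (lower_point Z p), (lower_point Z (E p)); split.
  + by case: p.
  + by case: (E p).
  + by apply/orP; left; apply/existsP; exists p; rewrite !eqxx.
- exists (upper_point X p), (upper_point X (D p)); split.
  + by case: p.
  + by case: (D p).
  + by apply/orP; right; apply/existsP; exists p; rewrite !eqxx.
Qed.

Let skip_X_split s t : triple_edge s t ->
  (exists a b, [/\ s = skip_X a, t = skip_X b & stack_edge D (tl_stack E G) a b]) \/
  (exists v w, [/\ s = lower_pair v, t = lower_pair w & stack_edge E G v w]).
Proof.
case/triple_edgeP=> -[p -> ->]; [right | right | left].
- exists (lower_point Y p), (lower_point Y (G p)); split=> //.
  by apply/orP; left; apply/existsP; exists p; rewrite !eqxx.
- exists (upper_point W p), (upper_point W (E p)); split.
  + by case: p.
  + by case: (E p).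
  + by apply/orP; right; apply/existsP; exists p; rewrite !eqxx.
- exists (upper_point W p), (upper_point W (D p)); split.
  + by case: p.
  + by case: (D p).
  + by apply/orP; right; apply/existsP; exists p; rewrite !eqxx.
Qed.

Let outerP X' Y' Z' (p : tl_points X' Z') : is_outer (outer_point Y' p).
Proof. by apply/existsP; exists p. Qed.

(** An arc of [tl_stack D E] is a shortcut for a path in the stack of [D] on [E], and the two graphs
    overlap only in outer points of that stack; so [connect_contract] applies. *)
Lemma skip_Y_connect a b :
  stack_connect (tl_stack D E) G a b = conn (skip_Y a) (skip_Y b).
Proof.
apply: (@connect_contract _ _ _ skip_Y upper_pair _ (stack_edge D E)) => //.
- move=> {}a {}b /orP[]/existsP[p /andP[/eqP-> /eqP->]].
    exact/connect1/bottom_edge.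
  have pE q : skip_Y (upper_point W q) = upper_pair (outer_point Y q) by case: q.
  rewrite !pE; apply: (connect_embed upper_pair_edge).
  by rewrite -/(stack_connect D E _ _) stack_connect_outer eqxx orbT.
- move=> {}a {}b v w /skip_Y_overlap[p -> ->] /skip_Y_overlap[q -> ->].
  rewrite -/(stack_connect D E _ _) stack_connect_outer.
  case/orP=> /eqP->; first exact: connect0.
  exact: stack_connect_upper.
Qed.

Lemma skip_X_connect a b :
  stack_connect D (tl_stack E G) a b = conn (skip_X a) (skip_X b).
Proof.
apply: (@connect_contract _ _ _ skip_X lower_pair _ (stack_edge E G)) => //.
- move=> {}a {}b /orP[]/existsP[p /andP[/eqP-> /eqP->]].
    have pE q : skip_X (lower_point Z q) = lower_pair (outer_point X q) by case: q.
    rewrite !pE; apply: (connect_embed lower_pair_edge).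
    by rewrite -/(stack_connect E G _ _) stack_connect_outer eqxx orbT.
  have := top_edge p; case: p (D p) => p [q|q]; exact: connect1.
- move=> {}a {}b v w /skip_X_overlap[p -> ->] /skip_X_overlap[q -> ->].
  rewrite -/(stack_connect E G _ _) stack_connect_outer.
  case/orP=> /eqP->; first exact: connect0.
  exact: stack_connect_lower.
Qed.

(** Both composites join the outer points that are connected in the triple stack. *)
Lemma tl_stackA : tl_stack D (tl_stack E G) = tl_stack (tl_stack D E) G.
Proof.
apply/eqP; rewrite -stacks_toE; apply/forallP=> p.
rewrite skip_Y_connect.
have eq_skip q : skip_Y (outer_point X q) = skip_X (outer_point Y q) by case: q.
by rewrite !eq_skip -skip_X_connect stack_connect_outer eqxx orbT.
Qed.

Definition X_point (x : 'I_(X.1)) : triple_points := inl (inl (inr x)).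
Definition Y_point (y : 'I_(Y.1)) : triple_points := inl (inr y).

Definition triple_closed (t : triple_points) : bool :=
  [forall w, ~~ conn t (inl (inl (inl w)))] && [forall z, ~~ conn t (inr z)].

(** A circle meeting both inner lines gets one representative on each; the two are matched in
    [circles_valueA]. *)
Definition X_right_end x : bool := triple_closed (X_point x) &&
  [forall x', conn (X_point x) (X_point x') ==> (x' <= x)].
Definition Y_right_end y : bool := triple_closed (Y_point y) &&
  [forall y', conn (Y_point y) (Y_point y') ==> (y' <= y)].
Definition meets_X y := [exists x, conn (Y_point y) (X_point x)].
Definition meets_Y x := [exists y, conn (X_point x) (Y_point y)].

Lemma circle_right_end_X x :
  circle_right_end (tl_stack D E) G x = X_right_end x.
Proof.
rewrite /circle_right_end /X_right_end; congr (_ && _).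
  apply/forallP/andP => [out|[/forallP outW /forallP outZ] [w|z]].
  - split; apply/forallP=> p.
      by have := out (inl p); rewrite skip_Y_connect.
    by have := out (inr p); rewrite skip_Y_connect.
  - by rewrite skip_Y_connect; exact: outW.
  - by rewrite skip_Y_connect; exact: outZ.
by apply: eq_forallb => x'; rewrite skip_Y_connect.
Qed.

Lemma circle_right_end_Y y :
  circle_right_end D (tl_stack E G) y = Y_right_end y.
Proof.
rewrite /circle_right_end /Y_right_end; congr (_ && _).
  apply/forallP/andP => [out|[/forallP outW /forallP outZ] [w|z]].
  - split; apply/forallP=> p.
      by have := out (inl p); rewrite skip_X_connect.
    by have := out (inr p); rewrite skip_X_connect.
  - by rewrite skip_X_connect; exact: outW.
  - by rewrite skip_X_connect; exact: outZ.
by apply: eq_forallb => x'; rewrite skip_X_connect.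
Qed.

Let lower_pair_inner v t :
  (forall p, ~~ stack_connect E G v (outer_point X p)) ->
  conn (lower_pair v) t -> exists2 w, t = lower_pair w & stack_connect E G v w.
Proof.
move=> v_in; apply: (connect_inner lower_pair_inj skip_X_split (outer := is_outer)).
  by move=> a w /skip_X_overlap[p _ ->]; exact: outerP.
move=> w vw; apply/existsP=> -[p /eqP def_w].
by have := v_in p; rewrite /stack_connect -def_w vw.
Qed.

Let upper_pair_inner v t :
  (forall p, ~~ stack_connect D E v (outer_point Y p)) ->
  conn (upper_pair v) t -> exists2 w, t = upper_pair w & stack_connect D E v w.
Proof.
move=> v_in; apply: (connect_inner upper_pair_inj skip_Y_split (outer := is_outer)).
  by move=> a w /skip_Y_overlap[p _ ->]; exact: outerP.
move=> w vw; apply/existsP=> -[p /eqP def_w].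
by have := v_in p; rewrite /stack_connect -def_w vw.
Qed.

(** The circles of the stack of [E] on [G] are the circles of the triple stack that meet X but not
    Y, since a component without outer points cannot be left. *)
Lemma circle_right_end_only_X x :
  circle_right_end E G x = X_right_end x && ~~ meets_Y x.
Proof.
apply/andP/andP => [[/forallP out /forallP right]|[]].
  have inner := lower_pair_inner out.
  split; [apply/andP; split; [apply/andP; split |] |].
  - apply/forallP=> w; apply/negP=> /inner[v [<-]].
    by apply/negP; exact: (out (inl w)).
  - by apply/forallP=> z; apply/negP=> /inner[v].
  - apply/forallP=> x'; apply/implyP=> /inner[v [<-] xx'].
    by have := right x'; rewrite xx'.
  - apply/existsP=> -[y /inner[v [<-]]].
    by apply/negP; exact: (out (inr y)).
case/andP=> /andP[/forallP outW _] /forallP right /existsPn outY; split.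
  apply/forallP=> p; apply/negP=> /(connect_embed lower_pair_edge).
  by case: p => [w|y]; apply/negP; [exact: outW | exact: outY].
apply/forallP=> x'; apply/implyP=> /(connect_embed lower_pair_edge) xx'.
by have := right x'; rewrite xx'.
Qed.

Lemma circle_right_end_only_Y y :
  circle_right_end D E y = Y_right_end y && ~~ meets_X y.
Proof.
apply/andP/andP => [[/forallP out /forallP right]|[]].
  have inner := upper_pair_inner out.
  split; [apply/andP; split; [apply/andP; split |] |].
  - by apply/forallP=> w; apply/negP=> /inner[[[?|?]|?]].
  - apply/forallP=> z; apply/negP=> /inner[[[?|?]|?] //= [<-]].
    by apply/negP; exact: (out (inr z)).
  - apply/forallP=> y'; apply/implyP=> /inner[[[?|?]|?] //= [<-]] yy'.
    by have := right y'; rewrite yy'.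
  - apply/existsP=> -[x /inner[[[?|?]|?] //= [<-]]].
    by apply/negP; exact: (out (inl x)).
case/andP=> /andP[_ /forallP outZ] /forallP right /existsPn outX; split.
  apply/forallP=> p; apply/negP=> /(connect_embed upper_pair_edge).
  by case: p => [x|z]; apply/negP; [exact: outX | exact: outZ].
apply/forallP=> y'; apply/implyP=> /(connect_embed upper_pair_edge) yy'.
by have := right y'; rewrite yy'.
Qed.

Definition triple_right_count (S : pred triple_points) t : nat :=
  match t with
  | inl (inl p) => right_count (S \o bottom_level) p
  | inl (inr y) => right_count (S \o middle_level) (inr y)
  | inr z => right_count (S \o top_level) (inr z)
  end.

Lemma triple_right_count_connect S s t :
    (forall s' t', triple_edge s' t' -> S t' = S s') -> ~~ S s -> conn s t ->
  odd (triple_right_count S t) = odd (triple_right_count S s).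
Proof.
move=> Sedge Ss st; suff [] : ~~ S t /\
  odd (triple_right_count S t) = odd (triple_right_count S s) by [].
move: t st; apply: (connect_from (P := fun t => ~~ S t /\
  odd (triple_right_count S t) = odd (triple_right_count S s))) => //.
move=> t t' [St <-] tt'.
rewrite (Sedge _ _ tt'); split=> //.
have mid p : triple_right_count S (middle_level p) =
  right_count (S \o middle_level) p by case: p.
have top p : triple_right_count S (top_level p) =
  right_count (S \o top_level) p by case: p.
case/triple_edgeP: tt' St => -[p -> ->] Sp.
- apply: right_count_arc => // [||q]; first exact: diagram_perfect.
    exact: diagram_noncrossing.
  exact/Sedge/bottom_edge.
- rewrite !mid; apply: right_count_arc => // [||q]; first exact: diagram_perfect.
    exact: diagram_noncrossing.
  exact/Sedge/middle_edge.
- rewrite !top; apply: right_count_arc => // [||q]; first exact: diagram_perfect.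
    exact: diagram_noncrossing.
  exact/Sedge/top_edge.
Qed.

Lemma card_ord_above n (i : 'I_n) : #|[pred i' : 'I_n | i < i']| = n - i.+1.
Proof.
rewrite -sum1_card -[RHS]muln1 -[RHS]sum_nat_const_nat big_geq_mkord.
exact: eq_bigl.
Qed.

(** Colors alternate and the rightmost ones agree, so only the parity of the distance from the right
    end matters. *)
Lemma region_color_odd (V V' : tl_obj) i i' : V.2 = V'.2 ->
  odd (V.1 - i) = odd (V'.1 - i') -> region_color V i = region_color V' i'.
Proof.
have iter_odd n u : iter n other_color u = iter (odd n) other_color u.
  elim: n => //= n ->; case: (odd n) => //=; exact: rev_ordK.
by move=> eqV2 eq_odd; rewrite /region_color iter_odd eq_odd eqV2 -iter_odd.
Qed.

(* To the right of its rightmost crossing with either line, a circle only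
   leaves points of its complement. *)
Lemma circle_color x y : X_right_end x -> Y_right_end y ->
    conn (X_point x) (Y_point y) ->
  region_color X x.+1 = region_color Y y.+1.
Proof.
case/andP=> _ /forallP right_x /andP[_ /forallP right_y] xy.
apply: region_color_odd; first exact: diagram_color E.
pose S := [pred t | ~~ conn (X_point x) t].
have Sedge s t : triple_edge s t -> S t = S s.
  move=> st; rewrite /S /= ![conn (X_point x) _]triple_connect_sym; congr (~~ _).
  apply: same_connect; first exact: triple_connect_sym.
  by rewrite triple_connect_sym connect1.
have Sx : ~~ S (X_point x) by rewrite negbK connect0.
have := triple_right_count_connect Sedge Sx xy.
rewrite -!card_ord_above => odd_xy; apply/esym; move: odd_xy.
congr (odd _ = odd _); apply: eq_card => i; rewrite !inE /= ?inE.
  case: (ltnP y i) => [lt_yi|]; rewrite ?andbF ?andbT //.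
  apply: contraTN lt_yi => xi; rewrite -leqNgt.
  have := right_y i; rewrite triple_connect_sym.
  by rewrite (connect_trans _ xy) // triple_connect_sym.
case: (ltnP x i) => [lt_xi|]; rewrite ?andbF ?andbT //.
apply: contraTN lt_xi => xi; rewrite -leqNgt.
by have := right_x i; rewrite xi.
Qed.

Lemma Y_right_end_connect x : X_right_end x -> meets_Y x ->
  exists y, forall y', Y_right_end y' && conn (X_point x) (Y_point y') = (y' == y).
Proof.
case/andP=> /andP[/forallP outW /forallP outZ] _ /existsP[y0 xy0].
case: (arg_maxnP (P := fun y => conn (X_point x) (Y_point y)) val xy0) => y xy y_max.
exists y => y'; apply/andP/eqP => [[/andP[_ /forallP right] xy']|->].
  apply/val_inj/eqP; rewrite eqn_leq; apply/andP; split; first exact: y_max.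
  have := right y; rewrite triple_connect_sym.
  by rewrite (connect_trans _ xy') // triple_connect_sym.
have yx : conn (Y_point y) (X_point x) by rewrite triple_connect_sym.
split=> //; apply/andP; split; last first.
  by apply/forallP=> y''; apply/implyP=> /(connect_trans xy); exact: y_max.
apply/andP; split; apply/forallP=> u; apply/negP=> /(connect_trans xy); apply/negP.
  exact: outW.
exact: outZ.
Qed.

Lemma X_right_end_connect y : Y_right_end y -> meets_X y ->
  exists x, forall x', X_right_end x' && conn (X_point x') (Y_point y) = (x' == x).
Proof.
case/andP=> /andP[/forallP outW /forallP outZ] _ /existsP[x0 yx0].
case: (arg_maxnP (P := fun x => conn (Y_point y) (X_point x)) val yx0) => x yx x_max.
exists x => x'; rewrite triple_connect_sym.
apply/andP/eqP => [[/andP[_ /forallP right] yx']|->].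
  apply/val_inj/eqP; rewrite eqn_leq; apply/andP; split; first exact: x_max.
  have := right x; rewrite triple_connect_sym.
  by rewrite (connect_trans _ yx') // triple_connect_sym.
split=> //; apply/andP; split; last first.
  by apply/forallP=> x''; apply/implyP=> /(connect_trans yx); exact: x_max.
apply/andP; split; apply/forallP=> u; apply/negP=> /(connect_trans yx); apply/negP.
  exact: outW.
exact: outZ.
Qed.

(** Circles meeting only one inner line give the same factors on both sides. A circle meeting both
    is counted at its right end on Y in the first product and at its right end on X in the second,
    with equal colors by [circle_color]. *)
Lemma circles_valueA (R : comNzRingType) (phi : {rmorphism A -> R}) :
  (circles_value phi D (tl_stack E G) * circles_value phi E G =
   circles_value phi (tl_stack D E) G * circles_value phi D E)%R.
Proof.
rewrite /circles_value (eq_bigl _ _ circle_right_end_X).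
rewrite (eq_bigl _ _ circle_right_end_Y) (eq_bigl _ _ circle_right_end_only_X).
rewrite (eq_bigl _ _ circle_right_end_only_Y).
rewrite (bigID meets_X) [X in (_ = X * _)%R](bigID meets_Y) /=.
rewrite -[LHS]mulrA -[RHS]mulrA; congr (_ * _)%R; last exact: mulrC.
pose wX (x : 'I_(X.1)) := (- phi (x_ (region_color X x.+1)))%R.
(* Both products become one double product over pairs of right ends on a common circle, whose inner
   product has a single factor. *)
transitivity (\prod_(y | Y_right_end y && meets_X y)
  \prod_(x | X_right_end x && conn (X_point x) (Y_point y)) wX x)%R.
  apply: eq_bigr => y /andP[Ry My]; have [x eqx] := X_right_end_connect Ry My.
  rewrite (big_pred1 _ eqx) /wX; have := eqx x; rewrite eqxx => /andP[Rx xy].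
  by rewrite (circle_color Rx Ry xy).
transitivity (\prod_(x | X_right_end x && meets_Y x)
  \prod_(y | Y_right_end y && conn (X_point x) (Y_point y)) wX x)%R; last first.
  apply: eq_bigr => x /andP[Rx Mx]; have [y eqy] := Y_right_end_connect Rx Mx.
  by rewrite (big_pred1 _ eqy).
rewrite (exchange_big_dep (fun x => X_right_end x && meets_Y x)) /=.
  apply: eq_bigr => x /andP[Rx Mx]; apply: eq_bigl => y; rewrite Rx /=.
  case: (boolP (conn _ _)) => [xy|]; rewrite ?andbF ?andbT //.
  suff -> : meets_X y by rewrite andbT.
  by apply/existsP; exists x; rewrite triple_connect_sym.
move=> y x _ /andP[-> xy]; apply/existsP; by exists y.
Qed.

End TripleStack.

(** * Identity diagrams and factorization *)

Section IdentityDiagram.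
Local Open Scope nat_scope.

(** A top point of the stack is joined by a vertical strand of the identity to the same top point of
    [E]. *)
Lemma stack_id_connect X Y (E : tl_diagram X Y) p :
  stack_connect (id_diagram Y) E (outer_point Y p) (lower_point Y p).
Proof.
case: p => [x|y]; first exact: connect0.
by have := stack_connect_upper (id_diagram Y) E (inr y); rewrite ffunE.
Qed.

Lemma tl_stack_id X Y (E : tl_diagram X Y) : tl_stack (id_diagram Y) E = E.
Proof.
apply/esym/eqP; rewrite -stacks_toE; apply/forallP=> p.
apply: (connect_trans (stack_id_connect E p)).
apply: (connect_trans (stack_connect_lower _ E p)).
rewrite -/(stack_connect _ _ _ _) stack_connect_sym; exact: stack_id_connect.
Qed.

Lemma circles_value_id (R : comNzRingType) (phi : {rmorphism A -> R})
    X Y (E : tl_diagram X Y) : circles_value phi (id_diagram Y) E = 1%R.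
Proof.
apply: big_pred0 => y; apply/negP=> /andP[/forallP/(_ (inr y))/negP[]].
rewrite stack_connect_sym; exact: (stack_id_connect E (inr y)).
Qed.

(** Each step raises [h] by at least one. Climbing from the first index to i gives h i >= i;
    climbing from i to the last index gives h i <= i. *)
Lemma increasing_ord_id n (h : 'I_n -> 'I_n) :
  (forall i j : 'I_n, i < j -> h i < h j) -> forall i, h i = i.
Proof.
move=> h_incr i.
have shift d : forall i j : 'I_n, j = i + d :> nat -> h i + d <= h j.
  elim: d => [|d IH] i1 j; first by rewrite !addn0 => /val_inj->.
  move=> def_j; have lt_n : i1 + d < n by have := ltn_ord j; lia.
  have := IH i1 (Ordinal lt_n) erefl.
  have := h_incr (Ordinal lt_n) j; rewrite /= def_j; lia.
have n_gt0 : 0 < n by have := ltn_ord i; lia.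
have n1_lt : n.-1 < n by lia.
have := shift i (Ordinal n_gt0) i erefl.
have := shift (n.-1 - i) i (Ordinal n1_lt).
have := ltn_ord i; have := ltn_ord (h (Ordinal n1_lt)).
by move=> /= ? ? h1 h2; apply: val_inj => /=; move: h1; lia.
Qed.

(** Top ranks run from right to left, so through strands in opposite order at the top would
    cross. *)
Lemma through_increasing X Y (D : tl_diagram X Y) (i i' : 'I_(X.1)) j j' :
  D (inl i) = inr j -> D (inl i') = inr j' -> i < i' -> j < j'.
Proof.
move=> Di Di' lt_i; have := matching_noncrossing (diagram_noncrossing D) (inl i) (inl i').
have neq_j : j != j'.
  apply: contraTneq lt_i => eq_j; rewrite -leqNgt.
  by move: Di'; rewrite -eq_j -Di => /(can_inj (diagramK D))[->].
have : (j : nat) != j' by [].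
rewrite Di Di' /=; have := ltn_ord i'; have := ltn_ord j; have := ltn_ord j'; lia.
Qed.

(** Without a cap, all bottom points are joined to top points in increasing order, which forces the
    identity. *)
Lemma not_id_cap X (D : tl_diagram X X) : D != id_diagram X ->
  exists i i', D (inl i) = inl i'.
Proof.
move=> neq_id; pose cap i := if D (inl i) is inl _ then true else false.
case: (pickP cap) => [i|no_cap].
  by rewrite /cap; case Di: (D (inl i)) => [i'|//] _; exists i, i'.
pose h i := if D (inl i) is inr j then j else i.
have Dh i : D (inl i) = inr (h i).
  by have := no_cap i; rewrite /cap /h; case: (D (inl i)).
have hE : forall i, h i = i.
  apply: increasing_ord_id => i j; exact: through_increasing.
case/eqP: neq_id; apply: diagram_eqP => -[i|i]; rewrite ffunE.
  by rewrite Dh hE.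
by rewrite -{1}(hE i) -Dh diagramK.
Qed.

(** A cap of the lower factor survives in the stack. *)
Lemma tl_stack_not_id X (D E : tl_diagram X X) :
  E != id_diagram X -> tl_stack D E != id_diagram X.
Proof.
case/not_id_cap=> i [i' Ei]; apply/eqP=> stack_id.
have : stack_connect D E (outer_point X (inl i)) (outer_point X (inl i')).
  by have := stack_connect_lower D E (inl i); rewrite Ei.
rewrite stack_connect_outer stack_id ffunE => /orP[/eqP eq_i|//].
by have := diagram_neq E (inl i); rewrite Ei eq_i eqxx.
Qed.

End IdentityDiagram.

Section Factorization.
Local Open Scope nat_scope.

(** Being noncrossing only involves the order of the ranks, so a [D]-stable set of boundary points
    listed in that order carries a diagram. *)
Lemma subdiagram X Y X' Y' (D : tl_diagram X Y)
    (psi : tl_points X' Y' -> tl_points X Y) :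
    X'.2 = Y'.2 ->
    (forall p q, boundary_rank p < boundary_rank q ->
       boundary_rank (psi p) < boundary_rank (psi q)) ->
    (forall p, exists q, psi q = D (psi p)) ->
  injective psi /\
  exists D' : tl_diagram X' Y', forall p, psi (D' p) = D (psi p).
Proof.
move=> eq_col psi_mono psi_stable.
have psi_inj : injective psi.
  move=> p q eq_pq; apply: boundary_rank_inj; apply/eqP.
  by case: ltngtP => // /psi_mono; rewrite eq_pq ltnn.
have psi_monoE p q : (boundary_rank p < boundary_rank q) =
    (boundary_rank (psi p) < boundary_rank (psi q)).
  apply/idP/idP; first exact: psi_mono.
  case: (ltngtP (boundary_rank p) (boundary_rank q)) => //.
    by move/psi_mono=> lt1 lt2; have := ltn_trans lt1 lt2; rewrite ltnn.
  by move/boundary_rank_inj->; rewrite ltnn.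
split=> //.
pose m := [ffun p => odflt p [pick q | psi q == D (psi p)]].
have mE p : psi (m p) = D (psi p).
  rewrite ffunE; case: pickP => [q /eqP // | no_q].
  by have [q /eqP] := psi_stable p; rewrite no_q.
have mP : [&& X'.2 == Y'.2, perfect_matching m & noncrossing m].
  rewrite eq_col eqxx /=; apply/andP; split; apply/forallP=> p.
    apply/andP; split; first by apply/eqP/psi_inj; rewrite !mE diagramK.
    by apply: contra (diagram_neq D (psi p)) => /eqP; rewrite -mE => ->.
  apply/forallP=> q; rewrite !psi_monoE !mE.
  exact: matching_noncrossing (diagram_noncrossing D) _ _.
by exists (TLDiagram mP).
Qed.

Lemma enum_val_increasing n (P : pred 'I_n) (l l' : 'I_#|P|) :
  l < l' -> enum_val l < enum_val l'.
Proof.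
move=> lt_l; pose x0 := enum_val l.
have sorted_enum : sorted (fun i j : 'I_n => i < j) (enum P).
  rewrite /enum_mem; apply: sorted_filter; first by move=> ? ? ?; exact: ltn_trans.
  by have := iota_ltn_sorted 0 n; rewrite -val_enum_ord sorted_map -enumT.
rewrite !(enum_val_nth x0).
apply: (sorted_ltn_nth _ _ sorted_enum) => //; first by move=> ? ? ?; exact: ltn_trans.
all: by rewrite inE -cardE.
Qed.

(* Cut the diagram along a horizontal line that only meets its through
   strands. *)
Lemma not_id_factor n u (D : tl_diagram (n, u) (n, u)) :
  D != id_diagram (n, u) ->
  exists k, k < n /\
  exists (E1 : tl_diagram (k, u) (n, u)) (E2 : tl_diagram (n, u) (k, u)),
    tl_stack E1 E2 = D /\
    forall (R : comNzRingType) (phi : {rmorphism A -> R}),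
      circles_value phi E1 E2 = 1%R.
Proof.
case/not_id_cap=> i0 [i1 Di0].
(* The lower ends of the through strands; their number is the number of middle points. *)
pose thr : pred 'I_n := fun i => if D (inl i) is inr _ then true else false.
pose k := #|thr|; pose x (l : 'I_k) : 'I_n := enum_val l.
have thrP i j : D (inl i) = inr j -> exists l, x l = i.
  move=> Di; have thr_i : i \in thr by rewrite unfold_in /thr Di.
  by exists (enum_rank_in thr_i i); rewrite /x enum_rankK_in.
have Dx l : exists j, D (inl (x l)) = inr j.
  have := enum_valP l; rewrite -/(x l) unfold_in /thr.
  by case: (D _) => // j _; exists j.
have x_incr (l l' : 'I_k) : l < l' -> x l < x l' by exact: enum_val_increasing.
have lt_kn : k < n.
  rewrite -[X in _ < X]card_ord -(cardC thr) -[X in X < _]addn0 ltn_add2l.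
  by apply/card_gt0P; exists i0; rewrite !inE unfold_in /thr Di0.
move: k x thrP Dx x_incr lt_kn => k x thrP Dx x_incr lt_kn {thr}.
exists k; split=> //.
pose K : tl_obj := (k, u); pose X : tl_obj := (n, u).
(* [E1] keeps the arcs between top points, [E2] those between bottom points, and both keep the
   through strands. A middle point stands for the lower end of its strand in [psi1] and for the
   upper end in [psi2]. *)
pose psi1 (p : tl_points K X) : tl_points X X :=
  match p with inl l => inl (x l) | inr j => inr j end.
pose psi2 (p : tl_points X K) : tl_points X X :=
  match p with inl i => inl i | inr l => D (inl (x l)) end.
have [|||psi1_inj [E1 E1P]] := @subdiagram X X K X D psi1 => //.
- move=> [l|j] [l'|j'] /=; first exact: x_incr.
  + by have := ltn_ord (x l); lia.
  + by have := ltn_ord l' => /=; lia.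
  + by lia.
- case=> [l|j] /=; first by have [j ->] := Dx l; exists (inr j).
  case Dj: (D (inr j)) => [i|j']; last by exists (inr j').
  have Di : D (inl i) = inr j by rewrite -Dj diagramK.
  by have [l <-] := thrP _ _ Di; exists (inl l).
have [|||psi2_inj [E2 E2P]] := @subdiagram X X X K D psi2 => //.
- move=> [i|l] [i'|l'] //=.
  + by have [j ->] := Dx l'; have := ltn_ord i => /=; lia.
  + by have := ltn_ord i' => /=; lia.
  + have [j Dj] := Dx l; have [j' Dj'] := Dx l'; rewrite Dj Dj' /=.
    have := ltn_ord l; have := ltn_ord l'; have := ltn_ord j => /= ? ? ? ?.
    have lt_l : (l' : 'I_k) < (l : 'I_k) by lia.
    have := through_increasing Dj' Dj (x_incr _ _ lt_l).
    by rewrite /=; lia.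
- case=> [i|l] /=; last by exists (inl (x l)); exact: esym (diagramK D _).
  case Di: (D (inl i)) => [i'|j]; first by exists (inl i').
  by have [l def_i] := thrP _ _ Di; exists (inr l); rewrite /= def_i.
have E2l l : E2 (inr l) = inl (x l).
  by apply: psi2_inj; rewrite E2P; exact: diagramK.
have mid_conn l : stack_connect E1 E2 (middle_point X X l)
    (@outer_point X K X (inl (x l))).
  by have := stack_connect_lower E1 E2 (inr l); rewrite E2l.
have through_conn i j : D (inl i) = inr j ->
    stack_connect E1 E2 (@outer_point X K X (inl i)) (@outer_point X K X (inr j)).
  move=> Di; have [l def_i] := thrP _ _ Di.
  have E1l : E1 (inl l) = inr j by apply: psi1_inj; rewrite E1P /psi1 def_i Di.
  apply: (@connect_trans _ _ (@middle_point X K X l)).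
    by rewrite -/(stack_connect _ _ _ _) stack_connect_sym -def_i; exact: mid_conn.
  by have := stack_connect_upper E1 E2 (inl l); rewrite E1l.
exists E1, E2; split; last first.
  move=> R phi; apply: big_pred0 => l.
  apply/negP=> /andP[/forallP/(_ (inl (x l)))/negP[]].
  exact: mid_conn.
apply/esym/eqP; rewrite -stacks_toE; apply/forallP=> -[i|j].
  case Di: (D (inl i)) => [i'|j]; last exact: through_conn.
  have E2i : E2 (inl i) = inl i' by apply: psi2_inj; rewrite E2P.
  by have := stack_connect_lower E1 E2 (inl i); rewrite E2i.
case Dj: (D (inr j)) => [i|j'].
  by rewrite stack_connect_sym; apply: through_conn; rewrite -Dj diagramK.
have E1j : E1 (inr j) = inr j' by apply: psi1_inj; rewrite E1P.
by have := stack_connect_upper E1 E2 (inr j); rewrite E1j.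
Qed.

End Factorization.

(** * Composition of linear combinations of diagrams *)

Section Composition.
Variables (R : comNzRingType) (phi : {rmorphism A -> R}).

Lemma tl_compE X Y Z (g : tl_hom R Y Z) (f : tl_hom R X Y) F :
  tl_comp phi g f F = \sum_D \sum_E
    (F == tl_stack D E)%:R * (circles_value phi D E * g D * f E).
Proof.
rewrite ffunE; apply: eq_bigr => D _; rewrite big_mkcond /=.
by apply: eq_bigr => E _; rewrite stacks_toE; case: eqP; rewrite ?mul1r ?mul0r.
Qed.

Lemma sum_tl_comp X Y Z (g : tl_hom R Y Z) (f : tl_hom R X Y)
    (h : tl_diagram X Z -> R) :
  \sum_F h F * tl_comp phi g f F =
  \sum_D \sum_E h (tl_stack D E) * (circles_value phi D E * g D * f E).
Proof.
under eq_bigr do rewrite tl_compE mulr_sumr.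
rewrite exchange_big; apply: eq_bigr => D _ /=.
under eq_bigr do rewrite mulr_sumr.
rewrite exchange_big; apply: eq_bigr => E _ /=.
rewrite (bigD1 (tl_stack D E)) //= eqxx mul1r big1 ?addr0 // => F /negbTE->.
by rewrite mul0r mulr0.
Qed.

Lemma tl_compA W X Y Z (h : tl_hom R Y Z) (g : tl_hom R X Y) (f : tl_hom R W X) :
  tl_comp phi h (tl_comp phi g f) = tl_comp phi (tl_comp phi h g) f.
Proof.
apply/ffunP=> F; rewrite [LHS]tl_compE [RHS]tl_compE [RHS]exchange_big /=.
transitivity (\sum_D \sum_E \sum_G
  (F == tl_stack D (tl_stack E G))%:R * (circles_value phi D (tl_stack E G) *
    circles_value phi E G * (h D * g E * f G))).
  apply: eq_bigr => D _.
  under eq_bigr do rewrite mulrA.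
  rewrite sum_tl_comp; apply: eq_bigr => E _; apply: eq_bigr => G _; ring.
transitivity (\sum_G \sum_D \sum_E
  (F == tl_stack D (tl_stack E G))%:R * (circles_value phi D (tl_stack E G) *
    circles_value phi E G * (h D * g E * f G))).
  by rewrite [RHS]exchange_big; apply: eq_bigr => D _; rewrite exchange_big.
apply: eq_bigr => G _.
(* [u K] is the weight with which [K], stacked on [G], contributes to [F]; [sum_tl_comp] then
   expands the inner composite. *)
pose u K := (F == tl_stack K G)%:R * circles_value phi K G * f G.
transitivity (\sum_K u K * tl_comp phi h g K); last first.
  by apply: eq_bigr => K _; rewrite /u; ring.
rewrite sum_tl_comp; apply: eq_bigr => D _; apply: eq_bigr => E _.
by rewrite /u circles_valueA tl_stackA; ring.
Qed.

End Composition.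

(** * Lifting projectors *)

Definition tl_basis (R : comNzRingType) X Y (D : tl_diagram X Y) : tl_hom R X Y :=
  [ffun E => (E == D)%:R].

Section CompositionTheory.
Variables (R : comNzRingType) (phi : {rmorphism A -> R}).

Lemma tl_comp_idl X Y (f : tl_hom R X Y) :
  tl_comp phi (tl_basis R (id_diagram Y)) f = f.
Proof.
apply/ffunP=> F; rewrite tl_compE (bigD1 (id_diagram Y)) //= [X in _ + X]big1.
  rewrite addr0 (bigD1 F) //= tl_stack_id circles_value_id ffunE !eqxx !mul1r.
  rewrite big1 ?addr0 // => E /negbTE neq_EF.
  by rewrite tl_stack_id eq_sym neq_EF mul0r.
move=> D /negbTE neq_id; apply: big1 => E _.
by rewrite ffunE neq_id mulr0 mul0r mulr0.
Qed.

Lemma tl_compBl X Y Z (g h : tl_hom R Y Z) (f : tl_hom R X Y) :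
  tl_comp phi (g - h) f = tl_comp phi g f - tl_comp phi h f.
Proof.
apply/ffunP=> F; rewrite !ffunE -sumrB; apply: eq_bigr => D _.
by rewrite -sumrB; apply: eq_bigr => E _; rewrite !ffunE; ring.
Qed.

Lemma tl_compBr X Y Z (g : tl_hom R Y Z) (f h : tl_hom R X Y) :
  tl_comp phi g (f - h) = tl_comp phi g f - tl_comp phi g h.
Proof.
apply/ffunP=> F; rewrite !ffunE -sumrB; apply: eq_bigr => D _.
by rewrite -sumrB; apply: eq_bigr => E _; rewrite !ffunE; ring.
Qed.

Lemma tl_comp0l X Y Z (f : tl_hom R X Y) :
  tl_comp phi (0 : tl_hom R Y Z) f = 0.
Proof. by rewrite -[X in tl_comp _ X](subrr 0) tl_compBl subrr. Qed.

(** Linearity in [f], which presents left composition with [g] as a matrix. *)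
Lemma tl_comp_basis_sum X Y Z (g : tl_hom R Y Z) (f : tl_hom R X Y) F :
  tl_comp phi g f F = \sum_E tl_comp phi g (tl_basis R E) F * f E.
Proof.
rewrite tl_compE exchange_big; apply: eq_bigr => E _ /=.
rewrite tl_compE mulr_suml; apply: eq_bigr => D _.
rewrite (bigD1 E) //= ffunE eqxx big1 ?addr0 ?mulr1 ?mulrA //.
by move=> E' /negbTE neq; rewrite ffunE neq !mulr0.
Qed.

Lemma tl_comp_basis X Y Z (D : tl_diagram Y Z) (E : tl_diagram X Y) F :
  tl_comp phi (tl_basis R D) (tl_basis R E) F =
  (F == tl_stack D E)%:R * circles_value phi D E.
Proof.
rewrite tl_compE (bigD1 D) //= [X in _ + X]big1 ?addr0; last first.
  move=> D' /negbTE neq; apply: big1 => E' _.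
  by rewrite !ffunE neq mulr0 mul0r mulr0.
rewrite (bigD1 E) //= [X in _ + X]big1 ?addr0; last first.
  by move=> E' /negbTE neq; rewrite !ffunE neq !mulr0.
by rewrite !ffunE !eqxx !mulr1.
Qed.

(** [D] factors through fewer strands without creating circles, and [f] kills the upper factor. *)
Lemma JW_basis_eq0 n u (f : tl_hom R (n, u) (n, u)) D :
  is_JW phi f -> D != id_diagram (n, u) -> tl_comp phi f (tl_basis R D) = 0.
Proof.
case=> _ f0 /not_id_factor[k [lt_kn [E1 [E2 [<- circ]]]]].
suff <- : tl_comp phi (tl_basis R E1) (tl_basis R E2) = tl_basis R (tl_stack E1 E2).
  by rewrite tl_compA f0 // tl_comp0l.
by apply/ffunP=> F; rewrite tl_comp_basis circ mulr1 ffunE.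
Qed.

End CompositionTheory.

(** * Base change of morphisms and projectors *)

Section BaseChange.
Variables (R S : comNzRingType) (phi : {rmorphism A -> R}) (psi : {rmorphism A -> S}).
Variable rho : {rmorphism R -> S}.
Hypothesis rho_phi : forall u, rho (phi (x_ u)) = psi (x_ u).

Lemma tl_base_change_comp X Y Z (g : tl_hom R Y Z) (f : tl_hom R X Y) :
  tl_base_change rho (tl_comp phi g f) =
  tl_comp psi (tl_base_change rho g) (tl_base_change rho f).
Proof.
apply/ffunP=> F; rewrite !ffunE rmorph_sum; apply: eq_bigr => D _.
rewrite rmorph_sum; apply: eq_bigr => E _; rewrite !rmorphM !ffunE.
congr (_ * _ * _); rewrite rmorph_prod; apply: eq_bigr => y _.
by rewrite rmorphN rho_phi.
Qed.

Lemma tl_base_change_basis X Y (D : tl_diagram X Y) :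
  tl_base_change rho (tl_basis R D) = tl_basis S D.
Proof. by apply/ffunP=> E; rewrite !ffunE rmorph_nat. Qed.

Lemma tl_base_change0 X Y : tl_base_change rho (0 : tl_hom R X Y) = 0.
Proof. by apply/ffunP=> E; rewrite !ffunE rmorph0. Qed.

(** A morphism over [S] need not come from [R], but it is a combination of diagrams, which do. *)
Lemma is_JW_base_change n u (f : tl_hom R (n, u) (n, u)) :
  is_JW phi f -> is_JW psi (tl_base_change rho f).
Proof.
case=> f1 f0; split; first by rewrite ffunE f1 rmorph1.
move=> k lt_kn g; apply/ffunP=> F; rewrite tl_comp_basis_sum ffunE big1 // => E _.
rewrite -tl_base_change_basis -tl_base_change_comp f0 // tl_base_change0 ffunE.
exact: mul0r.
Qed.

End BaseChange.

(** * Lifting along a map under which the preimages of 1 are units *)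

Section Lifting.
Variables (R : comUnitRingType) (S : comNzRingType).
Variables (phi : {rmorphism A -> R}) (psi : {rmorphism A -> S}).
Variables (rho : {rmorphism R -> S}) (sec : S -> R).
Hypothesis rho_phi : forall u, rho (phi (x_ u)) = psi (x_ u).
Hypothesis secK : cancel sec rho.
Hypothesis rho_unit : forall b, rho b = 1 -> b \is a GRing.unit.

(** The determinant of [M] is sent to 1 by [rho], hence is a unit. *)
Lemma family_inverse (T : finType) (M : T -> T -> R) :
  (forall F D, rho (M F D) = (F == D)%:R) ->
  exists N : T -> T -> R,
    (forall F G, \sum_D M F D * N D G = (F == G)%:R) /\
    (forall F G, \sum_D N F D * M D G = (F == G)%:R).
Proof.
move=> rhoM; pose Mx := \matrix_(i < #|T|, j < #|T|) M (enum_val i) (enum_val j).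
have Mx_unit : Mx \in unitmx.
  rewrite unitmxE; apply: rho_unit; rewrite -det_map_mx -[RHS](@det1 _ #|T|).
  by congr (\det _); apply/matrixP=> i j; rewrite !mxE rhoM (inj_eq enum_val_inj).
pose N F D := invmx Mx (enum_rank F) (enum_rank D).
have ME F D : M F D = Mx (enum_rank F) (enum_rank D).
  by rewrite mxE !enum_rankK.
exists N; split=> F G.
  transitivity ((Mx *m invmx Mx) (enum_rank F) (enum_rank G)).
    rewrite mxE (reindex (@enum_rank T)) /=; last exact/onW_bij/enum_rank_bij.
    by apply: eq_bigr => D _; rewrite ME.
  by rewrite mulmxV // mxE (inj_eq enum_rank_inj).
transitivity ((invmx Mx *m Mx) (enum_rank F) (enum_rank G)).
  rewrite mxE (reindex (@enum_rank T)) /=; last exact/onW_bij/enum_rank_bij.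
  by apply: eq_bigr => D _; rewrite ME.
by rewrite mulVmx // mxE (inj_eq enum_rank_inj).
Qed.

(* Write f = 1 - e, so that e is a left identity of the ideal of non-identity
   diagrams.  Composition with a lift e' of e is then invertible on that ideal,
   and if e' a = e' then e' (a g) = e' g, so a is a left identity as well. *)
Lemma is_JW_lift n u (f : tl_hom S (n, u) (n, u)) : is_JW psi f ->
  exists f' : tl_hom R (n, u) (n, u), is_JW phi f' /\ tl_base_change rho f' = f.
Proof.
move=> JWf; have [f1 f0] := JWf; pose X : tl_obj := (n, u).
pose e : tl_hom S X X := tl_basis S (id_diagram X) - f.
have e_id : e (id_diagram X) = 0 by rewrite !ffunE eqxx f1 subrr.
have eg k (g : tl_hom S (k, u) X) : (k < n)%N -> tl_comp psi e g = g.
  by move=> lt_kn; rewrite tl_compBl tl_comp_idl f0 // subr0.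
have eD D : D != id_diagram X -> tl_comp psi e (tl_basis S D) = tl_basis S D.
  by move=> neq; rewrite tl_compBl tl_comp_idl JW_basis_eq0 // subr0.
(* The identity coefficient is set to 0 by hand, since [sec] is a mere map and need not preserve
   0. *)
pose e' : tl_hom R X X := [ffun D => if D == id_diagram X then 0 else sec (e D)].
have rho_e' : tl_base_change rho e' = e.
  apply/ffunP=> D; rewrite ffunE [e' D]ffunE.
  by case: eqP => [->|_]; rewrite ?secK // rmorph0 e_id.
have rho_comp Y (D : tl_diagram Y X) F :
    rho (tl_comp phi e' (tl_basis R D) F) = tl_comp psi e (tl_basis S D) F.
  rewrite -rho_e' -(tl_base_change_basis rho D) -(tl_base_change_comp rho_phi).
  by rewrite [RHS]ffunE.
have e'_inj k (v : tl_hom R (k, u) X) : (k < n)%N ->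
    tl_comp phi e' v = 0 -> v = 0.
  move=> lt_kn e'v; have [|N [_ NM]] :=
    @family_inverse _ (fun F D => tl_comp phi e' (@tl_basis R (k, u) X D) F).
    by move=> F D; rewrite rho_comp eg // ffunE.
  apply/ffunP=> G; rewrite ffunE.
  transitivity (\sum_F N G F * tl_comp phi e' v F); last first.
    by rewrite e'v big1 // => F _; rewrite ffunE mulr0.
  under eq_bigr do rewrite tl_comp_basis_sum mulr_sumr.
  rewrite exchange_big /= (bigD1 G) //= [X in _ + X]big1.
    under eq_bigr do rewrite mulrA.
    by rewrite -mulr_suml NM eqxx mul1r addr0.
  move=> D /negbTE neq; under eq_bigr do rewrite mulrA.
  by rewrite -mulr_suml NM eq_sym neq mul0r.
(* The matrix of composition with [e'], with the identity column replaced by a unit column: [e]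
   fixes only the other diagrams, and the whole matrix must reduce to the identity. *)
pose M F D := if D == id_diagram X then (F == D)%:R
              else tl_comp phi e' (tl_basis R D) F.
have [|N [MN _]] := @family_inverse _ M.
  move=> F D; rewrite /M; case: eqP => [_|/eqP neq]; first by rewrite rmorph_nat.
  by rewrite rho_comp eD // ffunE.
pose a : tl_hom R X X := [ffun D => \sum_G N D G * e' G].
have Ma F : \sum_D M F D * a D = e' F.
  under eq_bigr do rewrite ffunE mulr_sumr.
  rewrite exchange_big /= (bigD1 F) //= [X in _ + X]big1.
    under eq_bigr do rewrite mulrA.
    by rewrite -mulr_suml MN eqxx mul1r addr0.
  move=> G /negbTE neq; under eq_bigr do rewrite mulrA.
  by rewrite -mulr_suml MN eq_sym neq mul0r.
(* The identity row of [M] is a unit row, because stacking on a non-identity diagram never gives the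
   identity. *)
have a_id : a (id_diagram X) = 0.
  have := Ma (id_diagram X); rewrite [RHS]ffunE eqxx => <-.
  rewrite (bigD1 (id_diagram X)) //= /M !eqxx mul1r big1 ?addr0 // => D neq.
  rewrite (negbTE neq) tl_compE big1 ?mul0r // => D' _; apply: big1 => E _.
  rewrite [tl_basis R D E]ffunE; case: (eqVneq E D) => [->|_]; last by rewrite !mulr0.
  by rewrite eq_sym (negbTE (tl_stack_not_id _ neq)) mul0r.
(* The replaced column is multiplied by the identity coefficient of [a], which is 0. *)
have e'a : tl_comp phi e' a = e'.
  apply/ffunP=> F; rewrite -[RHS]Ma tl_comp_basis_sum; apply: eq_bigr => D _.
  by rewrite /M; case: eqP => [->|//]; rewrite a_id !mulr0.
(* The reduction of [a] involves only non-identity diagrams, so [e] fixes it; but [e] also sends it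
   to [e]. *)
have rho_a : tl_base_change rho a = e.
  have e_a : tl_comp psi e (tl_base_change rho a) = e.
    by rewrite -rho_e' -(tl_base_change_comp rho_phi) e'a.
  have rho_a_id : tl_base_change rho a (id_diagram X) = 0.
    by rewrite ffunE a_id rmorph0.
  rewrite -[RHS]e_a; apply/ffunP=> F; rewrite tl_comp_basis_sum.
  rewrite (bigD1 F) //= [X in _ + X]big1 ?addr0.
    case: (eqVneq F (id_diagram X)) => [->|neq].
      by rewrite rho_a_id mulr0.
    by rewrite eD // [tl_basis S F F]ffunE eqxx mul1r.
  move=> D neq; case: (eqVneq D (id_diagram X)) => [->|neq'].
    by rewrite rho_a_id mulr0.
  by rewrite eD // [tl_basis S D F]ffunE eq_sym (negbTE neq) mul0r.
exists (tl_basis R (id_diagram X) - a); split; last first.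
  apply/ffunP=> F; have := congr1 (fun h : tl_hom S X X => h F) rho_a.
  by rewrite !ffunE rmorphB rmorph_nat => ->; rewrite subKr.
split; first by move: a_id; rewrite [LHS]ffunE => a_id; rewrite !ffunE eqxx a_id subr0.
move=> k lt_kn g; rewrite tl_compBl tl_comp_idl; apply: (e'_inj k) => //.
by rewrite tl_compBr tl_compA e'a subrr.
Qed.

End Lifting.

(** * The completion *)

Section IdealTheory.
Variables (R : comNzRingType) (I : R -> Prop).
Hypothesis I_ideal : is_ideal I.

Lemma ideal0 : I 0. Proof. by case: I_ideal. Qed.

Lemma idealD a b : I a -> I b -> I (a + b).
Proof. by case: I_ideal => _ h _; exact: h. Qed.

Lemma idealMl a b : I b -> I (a * b).
Proof. by case: I_ideal => _ _ h; exact: h. Qed.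

Lemma idealMr a b : I a -> I (a * b).
Proof. by rewrite mulrC; exact: idealMl. Qed.

Lemma idealN a : I a -> I (- a).
Proof. by rewrite -mulN1r; exact: idealMl. Qed.

Lemma idealB a b : I a -> I b -> I (a - b).
Proof. by move=> Ia /idealN; exact: idealD. Qed.

Lemma ideal_exp_expr a n : I a -> ideal_exp I n (a ^+ n).
Proof.
move=> Ia; elim: n => //= n IH; exists [:: (a, a ^+ n)].
by rewrite big_seq1 exprS; split=> // p /[!inE] /eqP->.
Qed.

End IdealTheory.

(** * Polynomials modulo the ideal of z_s and z_t *)

Section TwoIdeal.
Variables (k : comNzRingType) (phi : {rmorphism A -> k}).
Notation I := (two_ideal phi).

Lemma two_ideal_ideal : is_ideal I.
Proof.
split.
- by exists (fun=> 0); rewrite big1 // => i _; rewrite mul0r.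
- move=> a b [c ->] [d ->]; exists (fun i => c i + d i).
  by rewrite -big_split; apply: eq_bigr => i _; rewrite mulrDl.
- move=> a b [c ->]; exists (fun i => a * c i).
  by rewrite mulr_sumr; apply: eq_bigr => i _; rewrite mulrA.
Qed.

(** The property holds for constants and variables and is stable under sums and products. *)
Lemma two_ideal_eval (p : {mpoly k[2]}) : I (p - (p.@[two_ phi])%:MP).
Proof.
have idealI := two_ideal_ideal.
pose P (p : {mpoly k[2]}) := I (p - (p.@[two_ phi])%:MP).
have PM q r : P q -> P r -> P (q * r).
  rewrite /P => Pq Pr; rewrite mevalM mpolyCM.
  rewrite (_ : _ - _ = q * (r - (r.@[two_ phi])%:MP)
    + (r.@[two_ phi])%:MP * (q - (q.@[two_ phi])%:MP)); last by ring.
  by apply: idealD => //; apply: idealMl.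
have PC c : P c%:MP by rewrite /P mevalC subrr; exact: ideal0.
have PX i : P 'X_i.
  rewrite /P mevalXU; exists (fun j => (j == i)%:R).
  rewrite (bigD1 i) //= eqxx mul1r big1 ?addr0 // => j /negbTE->.
  exact: mul0r.
elim/mpolyind: p => [|c m p _ _ Pp]; first exact: (PC 0).
rewrite mevalD mpolyCD opprD addrACA; apply: idealD => //.
rewrite -mul_mpolyC; apply: (PM _ _ (PC c)); rewrite mpolyXE_id.
apply: (big_ind P) => [|//|i _]; first exact: (PC 1).
elim: (m i) => [|d IH]; first exact: (PC 1).
by rewrite exprS; exact: PM.
Qed.

End TwoIdeal.

(** * Units of the completion *)

Section Completion.
Variables (k : idomainType) (phi : {rmorphism A -> k}).
Variables (Ahat : idomainType) (C : adic_completion (two_ideal phi) Ahat).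
Variables (eps : {rmorphism Ahat -> k}) (heps : is_special_fibre C eps).
Notation I := (two_ideal phi).

Lemma adic_ker0 n : adic_ker C n 0.
Proof. exact: ideal0 (adic_ker_ideal C n). Qed.

Lemma special_fibre_map p : eps (adic_map C p) = p.@[two_ phi].
Proof. by apply: heps; rewrite subrr; exact: adic_ker0. Qed.

Lemma adic_ker_le n m b : (n <= m)%N -> adic_ker C m b -> adic_ker C n b.
Proof.
by elim: m => [|m IH]; rewrite leq_eqVlt => /predU1P[->//|] // /IH h /adic_ker_decr.
Qed.

(** Both [b] and 0 are limits of the zero sequence. *)
Lemma adic_separated b : (forall n, adic_ker C n b) -> b = 0.
Proof.
move=> b_ker; have [|c [_ c_uniq]] := @adic_lim _ _ _ C (fun=> 0).
  by move=> n; rewrite subrr -(adic_ker_map C) rmorph0; exact: adic_ker0.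
rewrite -(c_uniq b) ?(c_uniq 0) // => n; rewrite rmorph0 subr0 //.
exact: adic_ker0.
Qed.

(** Approximate [b] by a polynomial [p]. It vanishes at the special point, so its power lies in the
    power of the ideal, and the difference of the two powers is divisible by the error. *)
Lemma special_fibre_kerX b n : eps b = 0 -> adic_ker C n.+1 (b ^+ n.+1).
Proof.
move=> eps_b; have [p bp] := adic_ker_surj C n.+1 b.
have idealK := adic_ker_ideal C n.+1.
have Ip : I p.
  have := two_ideal_eval phi p; rewrite -(heps (adic_ker_le _ bp)) // eps_b.
  by rewrite mpolyC0 subr0.
rewrite -[b ^+ _](subrK (adic_map C p ^+ n.+1)); apply: idealD => //.
  by rewrite subrXX; exact: idealMr.
rewrite -rmorphXn /= adic_ker_map; exact: ideal_exp_expr.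
Qed.

(* The inverse of 1 - b is the limit of the geometric series. *)
Lemma special_fibre_unit a : eps a = 1 -> a \is a GRing.unit.
Proof.
move=> eps_a; pose b := 1 - a; pose s n := \sum_(i < n) b ^+ i.
have eps_b : eps b = 0 by rewrite rmorphB rmorph1 eps_a subrr.
have as_ n : a * s n = 1 - b ^+ n.
  by rewrite -(subKr 1 a) -/b -[1 in RHS](expr1n _ n) subrXX;
     congr (_ * _); apply: eq_bigr => i _; rewrite expr1n mul1r.
have kerX n : adic_ker C n (b ^+ n).
  (* The kernel of index 0 is all of [Ahat], since the zeroth power of the ideal is the whole
     ring. *)
  case: n => [|n]; last exact: special_fibre_kerX.
  have [p] := adic_ker_surj C 0 (b ^+ 0).
  move=> h; rewrite -[b ^+ 0](subrK (adic_map C p)).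
  by apply: (idealD (adic_ker_ideal C 0) h); rewrite adic_ker_map.
(* [adic_lim] takes sequences of polynomials, so each partial sum is first approximated by one. *)
have [r r_s] : exists r : nat -> {mpoly k[2]},
    forall n, adic_ker C n (s n - adic_map C (r n)).
  apply: (functional_choice (fun n p => adic_ker C n (s n - adic_map C p))) => n.
  exact: adic_ker_surj.
have [n|u [u_lim _]] := @adic_lim _ _ _ C r.
  rewrite -(adic_ker_map C) rmorphB /=.
  have idealK := adic_ker_ideal C n.
  rewrite (_ : _ - _ = (s n - adic_map C (r n))
    - (s n.+1 - adic_map C (r n.+1)) + b ^+ n); last first.
    by rewrite [s n.+1]big_ord_recr /= -/(s n); ring.
  apply: idealD => //; apply: idealB => //.
  exact: adic_ker_decr.
apply/unitrPr; exists u; apply/eqP; rewrite -subr_eq0; apply/eqP.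
apply: adic_separated => n; have idealK := adic_ker_ideal C n.
(* Modulo the n-th kernel, [u] agrees with [s n], and [a * s n] is 1 up to the n-th power of [b]. *)
rewrite (_ : _ - 1 = a * ((u - adic_map C (r n)) - (s n - adic_map C (r n)))
  - b ^+ n); last first.
  rewrite -[in RHS](opprK (b ^+ n)) -[- b ^+ n](addKr 1) -as_; ring.
by apply: idealB => //; apply: idealMl => //; apply: idealB.
Qed.

End Completion.

Theorem theorem6p17 (k : idomainType) (phi : {rmorphism A -> k})
    (hk : is_henselian_local_ring k)
    (Ahat : idomainType) (C : adic_completion (two_ideal phi) Ahat)
    (eps : {rmorphism Ahat -> k}) (heps : is_special_fibre C eps)
    (n : nat) (f : tl_hom k (n, col_s) (n, col_s)) (hf : is_JW phi f) :
  exists fhat : tl_hom Ahat (n, col_s) (n, col_s),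
    is_JW (hat_str C) fhat /\
    tl_base_change eps fhat = f /\
    is_JW (frac_str (hat_str C)) (tl_base_change (frac_map Ahat) fhat).
Proof.
have eps_str u : eps (hat_str C (x_ u)) = phi (x_ u).
  by rewrite (special_fibre_map heps) /x_ /= map_mpolyX mevalXU.
(* Evaluation fixes constants, so constant polynomials give a section of [eps]. *)
pose sec (c : k) := adic_map C c%:MP.
have secK : cancel sec eps by move=> c; rewrite (special_fibre_map heps) mevalC.
have [fhat [JW_fhat fhat_f]] :=
  is_JW_lift eps_str secK (special_fibre_unit heps) hf.
by exists fhat; split=> //; split=> //; apply: is_JW_base_change JW_fhat.
Qed.
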